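(* Let $n\ge3$, $0<p<2$, $n\left(\frac12p-1\right)<\alpha<n\left(\frac{n-1}{n}p-1\right)$ and $\alpha\le0$. Then for every $f\in BL^{p,2}_{|x|^\alpha}$ on $\mathbf{R}^n$, $$\|A_tf-f\|_{L^p_{|x|^\alpha}}\to0\quad\text{as }t\to0.$$
   Context: Spherical means: $A_t(f)(x)=\int_{\mathbf{S}^{n-1}}f(x-t\theta)\,d\sigma(\theta)$ for $t>0$, where $d\sigma$ is normalized Lebesgue measure on the unit sphere $\mathbf{S}^{n-1}\subset\mathbf{R}^n$. Also $\|g\|_{L^p_{|x|^\alpha}}=\left(\int_{\mathbf{R}^n}|g(x)|^p|x|^\alpha dx\right)^{1/p}$. Blocks: for $\alpha\in\mathbf{R}$, $0<p<\infty$, $0<s\le\infty$, a function $a$ on $\mathbf{R}^n$ is a $(p,s,\alpha)$-block if there is a ball $B(x_0,r)=\{x:|x-x_0|\le r\}$ with $x_0\in\mathbf{R}^n$, $r>0$, such that $\operatorname{supp}a\subseteq B(x_0,r)$ and $\|a\|_{L^s}\le|B(x_0,r)|^{-\frac{\alpha}{pn}-\frac1p+\frac1s}$ ($|\cdot|$ is Lebesgue measure). Let $\bar p=\min\{p,1\}$. The space $BL^{p,s}_{|x|^\alpha}$ consists of all $f=\sum_{k}\lambda_ka_k$ (countable sum, convergence a.e.), where each $a_k$ is a $(p,s,\alpha)$-block and $\sum_k|\lambda_k|^{\bar p}<\infty$. Here $s=2$. *)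

(* Defs.v *)
From HB Require Import structures.
From mathcomp Require Import all_boot all_order all_algebra.
From mathcomp Require Import complex.
From mathcomp Require Import all_classical all_reals all_analysis.
From mathcomp Require Import measurable_realfun.

Set Implicit Arguments.
Unset Strict Implicit.
Unset Printing Implicit Defensive.

Import Order.TTheory GRing.Theory Num.Theory.
Import numFieldNormedType.Exports.

Local Open Scope classical_set_scope.
Local Open Scope ring_scope.

(* R^n is [n.-tuple R], whose canonical sigma-algebra is the product (Borel)
   one. *)
Section euclidean_space.
Context {R : realType} {n : nat}.
Implicit Types x y : n.-tuple R.

Definition vzero : n.-tuple R := [tuple 0 | i < n].
Definition vsub x y : n.-tuple R := [tuple tnth x i - tnth y i | i < n].
Definition vscale (c : R) x : n.-tuple R := [tuple c * tnth x i | i < n].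
Definition enorm x : R := Num.sqrt (\sum_(i < n) tnth x i ^+ 2).

Definition eball (x0 : n.-tuple R) (r : R) : set (n.-tuple R) :=
  [set x | enorm (vsub x x0) <= r].
Definition usphere : set (n.-tuple R) := [set x | enorm x = 1].
Definition vdirection x : n.-tuple R := vscale (enorm x)^-1 x.

Lemma measurable_enorm : measurable_fun [set: n.-tuple R] enorm.
Proof.
apply: (@measurableT_comp _ _ _ _ _ _ (@Num.sqrt R)).
  by apply: continuous_measurable_fun; exact: sqrt_continuous.
by apply: measurable_sum => i; apply: measurable_funX; exact: measurable_tnth.
Qed.

Lemma measurable_eball x0 r : measurable (eball x0 r).
Proof.
have mv : measurable_fun [set: n.-tuple R] (vsub ^~ x0).
  apply/measurable_fun_tnthP => i; rewrite /comp.
  under eq_fun do rewrite tnth_mktuple.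
  by apply: measurable_funB => //; exact: measurable_tnth.
rewrite -[eball _ _]setTI.
have -> : eball x0 r = (enorm \o (vsub ^~ x0)) @^-1` `]-oo, r].
  by apply/seteqP; split => x; rewrite /eball /= in_itv.
exact: (measurableT_comp measurable_enorm mv).
Qed.

Lemma measurable_vdirection : measurable_fun [set: n.-tuple R] vdirection.
Proof.
apply/measurable_fun_tnthP => i; rewrite /comp.
under eq_fun do rewrite tnth_mktuple -powR_inv1 ?sqrtr_ge0//.
apply: measurable_funM; last exact: measurable_tnth.
by apply: (@measurableT_comp _ _ _ _ _ _ (@powR R ^~ (-1))) => //;
  exact: measurable_enorm.
Qed.

End euclidean_space.

(* Lebesgue measure on R^n (on Borel sets) as the n-fold product of the
   Lebesgue measure on R. *)
Section lebesgue_cons.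
Context {R : realType} {n : nat}.
Variable mu : {sigma_finite_measure set (n.-tuple R) -> \bar R}.

Definition vcons (u : measurableTypeR R * n.-tuple R) : n.+1.-tuple R :=
  [tuple of u.1 :: u.2].

Lemma measurable_vcons : measurable_fun [set: _] vcons.
Proof.
exact: (measurable_cons (measurable_fst : measurable_fun _ (fst : _ -> R))
          measurable_snd).
Qed.

Definition lebesgue_cons : set (n.+1.-tuple R) -> \bar R :=
  pushforward (lebesgue_measure \x mu)%E vcons.

Local Notation cons_measure :=
  (measure_function_pushforward__canonical__measure_function_Measure
     (lebesgue_measure \x mu)%E measurable_vcons).

HB.instance Definition _ := isMeasure.Build _ _ _ lebesgue_cons
  (@measure0 _ _ _ cons_measure) (@measure_ge0 _ _ _ cons_measure)
  (@measure_semi_sigma_additive _ _ _ cons_measure).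

Let sigma_finite_lebesgue_cons : sigma_finite setT lebesgue_cons.
Proof.
have /sigma_finiteP[F [TF ndF Foo]] := sigma_finiteT (@lebesgue_measure R).
have /sigma_finiteP[G [TG ndG Goo]] := sigma_finiteT mu.
pose vuncons (x : n.+1.-tuple R) : measurableTypeR R * n.-tuple R :=
  (thead x, [tuple of behead x]).
have vconsK : cancel vcons vuncons.
  by case=> a x; rewrite /vuncons /vcons /=; congr pair; exact/val_inj.
have mvuncons : measurable_fun setT vuncons.
  apply/measurable_fun_pairP; split; last exact: measurable_behead.
  exact: measurable_tnth.
exists (fun k => vuncons @^-1` (F k `*` G k)).
  rewrite -preimage_bigcup -[LHS](preimage_setT vuncons); congr (_ @^-1` _).
  apply/esym/seteqP; split => // -[x y] _.
  have [k _ Fkx] : (\bigcup_i F i) x by rewrite -TF.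
  have [l _ Gly] : (\bigcup_i G i) y by rewrite -TG.
  exists (maxn k l) => //; split.
    by move: x Fkx; exact/subsetPset/ndF/leq_maxl.
  by move: y Gly; exact/subsetPset/ndG/leq_maxr.
move=> k; have [mF Fk] := Foo k; have [mG Gk] := Goo k; split.
  by rewrite -[X in measurable X]setTI; apply: mvuncons => //; exact: measurableX.
rewrite /lebesgue_cons /pushforward -comp_preimage.
have -> : vuncons \o vcons = id by apply/funext => u /=; rewrite vconsK.
by rewrite preimage_id product_measure1E// lte_mul_pinfty// ge0_fin_numE.
Qed.

HB.instance Definition _ := Measure_isSigmaFinite.Build _ _ _ lebesgue_cons
  sigma_finite_lebesgue_cons.

End lebesgue_cons.

Fixpoint lebesgue_Rn (R : realType) (n : nat) :
    {sigma_finite_measure set (n.-tuple R) -> \bar R} :=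
  match n with
  | 0 => dirac [tuple]
  | m.+1 => lebesgue_cons (lebesgue_Rn R m)
  end.

Lemma lebesgue_Rn_box (R : realType) (n : nat) (A : 'I_n -> set R) :
  (forall i, measurable (A i)) ->
  lebesgue_Rn R n [set x | forall i, A i (tnth x i)] =
  (\prod_(i < n) lebesgue_measure (A i))%E.
Proof.
elim: n => [|n IH] in A *; move=> mA.
  by rewrite big_ord0 /= diracE mem_set//= => -[].
rewrite big_ord_recl -IH//= -product_measure1E//; first last.
- rewrite (_ : mkset _ =
      \bigcap_(i in [set: 'I_n]) ((fun x => tnth x i) @^-1` A (lift ord0 i))).
    apply: fin_bigcap_measurable => // i _.
    by rewrite -[X in measurable X]setTI; exact: measurable_tnth.
  by apply/seteqP; split => x /= Ax i; first move=> _; apply: Ax.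
- exact: (mA ord0 : measurable (A ord0 : set (measurableTypeR R))).
rewrite /lebesgue_cons /pushforward; congr (product_measure1 _ _ _).
apply/seteqP; split => -[a x] /=.
  move=> Aax; split; first exact: (Aax ord0).
  by move=> i; have := Aax (lift ord0 i); rewrite tnthS.
move=> [Aa Ax] i; case: (unliftP ord0 i) => [j ->|->]//.
by rewrite tnthS; exact: Ax.
Qed.

(* Normalized surface measure: sigma(A) is the proportion of the unit ball
   occupied by the cone { r w | 0 < r <= 1, w \in A } (polar coordinates).  The
   origin, where [vdirection] takes the irrelevant value 0, is Lebesgue-null. *)
Section sphere_measure.
Context {R : realType} {n : nat}.
Let mu := lebesgue_Rn R n.
Let B : set (n.-tuple R) := eball vzero 1.

Definition sphere_measure : set (n.-tuple R) -> \bar R := fun A =>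
  ((fine (mu B))^-1%:E * mu (vdirection @^-1` A `&` B))%E.

Let invB_ge0 : 0 <= (fine (mu B))^-1.
Proof. by rewrite invr_ge0 fine_ge0. Qed.

Local Notation smeasure :=
  (measure_function_mscale__canonical__measure_function_Measure
    (NngNum invB_ge0)
    (measure_function_pushforward__canonical__measure_function_Measure
      (mrestr mu (measurable_eball vzero 1)) measurable_vdirection)).

HB.instance Definition _ := isMeasure.Build _ _ _ sphere_measure
  (@measure0 _ _ _ smeasure) (@measure_ge0 _ _ _ smeasure)
  (@measure_semi_sigma_additive _ _ _ smeasure).

End sphere_measure.

Section block_spaces.
Context {R : realType} {n : nat}.
Local Notation Rn := (n.-tuple R).
Local Notation mu := (lebesgue_Rn R n).

Definition cabs (z : R[i]) : R := Normc.normc z.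

(* Where theta |-> f (x - t theta) is not sigma-integrable the integrals below
   have a conventional value; for f in the block spaces considered this only
   concerns a null set of x. *)
Definition spherical_mean (f : Rn -> R[i]) (t : R) (x : Rn) : R[i] :=
  let g theta := f (vsub x (vscale t theta)) in
  Complex (\int[sphere_measure]_(theta in usphere) complex.Re (g theta))
          (\int[sphere_measure]_(theta in usphere) complex.Im (g theta)).

Definition weighted_norm (p alpha : R) (g : Rn -> R[i]) : \bar R :=
  ((\int[mu]_x (cabs (g x) `^ p * enorm x `^ alpha)%:E) `^ p^-1)%E.

Definition cmeasurable (a : Rn -> R[i]) : Prop :=
  measurable_fun setT (fun x => complex.Re (a x)) /\
  measurable_fun setT (fun x => complex.Im (a x)).

(* As the ball is closed, supp a is included in it as soon as a vanishes
   outside.  [fine (s^-1)] is 1/s, with value 0 for s = +oo. *)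
Definition block (p : R) (s : \bar R) (alpha : R) (a : Rn -> R[i]) : Prop :=
  cmeasurable a /\
  exists (x0 : Rn) (r : R), [/\ 0 < r,
    forall x, ~ eball x0 r x -> a x = 0 &
    ('N[mu]_s [EFin \o (cabs \o a)] <=
     mu (eball x0 r) `^ (- (alpha / (p * n%:R)) - p^-1 + fine (s^-1)%E))%E].

(* Blocks may be taken Borel measurable: every Lebesgue measurable block
   agrees almost everywhere with a Borel one, and membership in the space is
   insensitive to null sets. *)
Definition block_space (p : R) (s : \bar R) (alpha : R) : set (Rn -> R[i]) :=
  [set f | exists (lambda : nat -> R[i]) (a : nat -> Rn -> R[i]),
    [/\ forall k, block p s alpha (a k),
      (\sum_(0 <= k <oo) (cabs (lambda k) `^ Num.min p 1)%:E < +oo)%E &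
      {ae mu, forall x,
        cabs (f x - \sum_(k < N) lambda k * a k x) @[N --> \oo] --> 0}]].

End block_spaces.

(* Main.v *)
From HB Require Import structures.
Require Import Defs.
From mathcomp Require Import all_boot all_order all_algebra.
From mathcomp Require Import complex.
From mathcomp Require Import all_classical all_reals all_analysis.
From mathcomp Require Import measurable_realfun.
From mathcomp Require Import ring lra.
Import Order.TTheory GRing.Theory Num.Theory.
Import numFieldNormedType.Exports.
Local Open Scope classical_set_scope.
Local Open Scope ring_scope.

(** Write w(x) = |x|^alpha, q = p/2 and s = alpha + n - np/2.

    The heart of the matter is a bound that is uniform in the block and in t.
    If u lives in a ball of radius r, then A_t|u| lives in the concentric ball
    of radius rho = r + t, and A_t|u|(x) only sees directions in a spherical
    cap of measure O((r/rho)^(n-1)) ([sphere_cap_le]).  By Cauchy-Schwarz,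
    (A_t|u|)^2 <= C (r/rho)^(n-1) A_t(u^2), and A_t preserves the integral of
    u^2.  On the other hand |x|^beta with beta = alpha/(1-q) > -n has integral
    O(rho^(n+beta)) over every ball of radius rho ([integral_weight_ball]).
    Interpolating between the two,
      int (A_t|u|)^p w <= C ||u||_2^p (r/rho)^((n-1)q) rho^s,
    and the upper bound on alpha gives s <= (n-1)q, so that this is at most
    C ||u||_2^p r^s ([sph_bound]), a constant when u is a block.

    For one fixed u in L^2 with support in a ball, int |A_t u - u|^p w tends to
    0.  When u is the indicator of a bounded set whose boundary is null, for
    almost every x one has A_t u(x) = u(x) as soon as t is small, and dominated
    convergence applies.  Such sets form a pi-system generating the Borel sets,
    and the uniform bound makes the class of all suitable u closed under L^2
    limits; the pi-lambda theorem and approximation by simple functions then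
    give every u ([L2_on_mean_cvg]).

    For f = sum_k lambda_k a_k the uniform bound first shows that
    sum_k |lambda_k| A_t|a_k| is finite almost everywhere, so that
    A_t f = sum_k lambda_k A_t a_k there, by dominated convergence on the
    sphere ([avg_cvg]).  The pointwise inequality
      (sum_k c_k y_k)^p <= C sum_k c_k^(min(p,1)) y_k^p
    ([poweR_nneseries_le]) then bounds int |A_t f - f|^p w by a series whose
    terms tend to 0 with t and are dominated by a multiple of
    |lambda_k|^(min(p,1)), and Tannery's theorem concludes
    ([tends0_superposition]).

    A function in the block space is only almost everywhere equal to a Borel
    function, so its spherical means and the final integral are integrals of
    functions that may fail to be measurable.  They are compared with
    integrals of measurable functions off a null set
    ([eq_integral_ae], [integral_le_ae]). *)

(** * Affine changes of variables in R^n *)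

Section affine.
Context {R : realType}.
Local Notation leb := (@lebesgue_measure R).
Local Open Scope ereal_scope.

Lemma measurable_affine (c b : R) :
  measurable_fun setT (fun a : measurableTypeR R => (c * a + b)%R : measurableTypeR R).
Proof. by apply: measurable_funD => //; exact: measurable_funM. Qed.

(** Both sides are measures, so it is enough to compare them on half-open
    intervals. *)
Lemma lebesgue_measure_affine (c b : R) (A : set (measurableTypeR R)) :
  (0 < c)%R -> measurable A ->
  leb ((fun a => c * a + b)%R @^-1` A) = (c^-1)%:E * leb A.
Proof.
move=> c0 mA.
have ci0 : (0 <= c)%R by rewrite ltW.
pose m := mscale (NngNum ci0)
  (measure_function_pushforward__canonical__measure_function_Measure
     leb (measurable_affine c b)).
have -> : leb A = m A.
  apply: lebesgue_measure_unique => // _ [[x y] _ <-].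
  change (leb `]x, y] = c%:E * leb ((fun a => c * a + b)%R @^-1` `]x, y]%classic)).
  have -> : (fun a => c * a + b)%R @^-1` `]x, y]%classic = `](x - b) / c, (y - b) / c]%classic%R.
    apply/seteqP; split => a /=; rewrite !in_itv/= ltr_pdivrMr// ler_pdivlMr//;
      by rewrite ltrBlDr lerBrDr (mulrC a).
  rewrite !lebesgue_measure_itv/= !lte_fin ltr_pM2r ?invr_gt0// ltrD2r.
  case: ifP => xy; last by rewrite mule0.
  rewrite -!EFinB -EFinM; congr EFin; field; exact: lt0r_neq0.
change (leb ((fun a => c * a + b)%R @^-1` A) =
  (c^-1)%:E * (c%:E * leb ((fun a => c * a + b)%R @^-1` A))).
by rewrite muleA -EFinM mulVf ?lt0r_neq0// mul1e.
Qed.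

Lemma ge0_integral_affine (c b : R) (g : R -> \bar R) :
  (0 < c)%R -> measurable_fun setT (g : measurableTypeR R -> _) -> (forall a, 0 <= g a) ->
  \int[leb]_a g (c * a + b)%R = (c^-1)%:E * \int[leb]_a g a.
Proof.
move=> c0 mg g0.
have ci0 : (0 <= c^-1)%R by rewrite invr_ge0 ltW.
rewrite -(@ge0_integral_mscale _ _ _ leb setT measurableT (NngNum ci0))//.
rewrite -[LHS]/(\int[leb]_(a in (fun a : measurableTypeR R => c * a + b : measurableTypeR R)%R @^-1` setT)
   (g \o (fun a => c * a + b)%R) a).
rewrite -(@ge0_integral_pushforward _ _ _ _ _ _ (measurable_affine c b))//.
apply: eq_measure_integral; first exact: measurable_affine.
by move=> mphi A mA _; exact: (lebesgue_measure_affine c b A c0 mA).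
Qed.

End affine.

Section vectors.
Context {R : realType}.
Implicit Types (n : nat).

Definition vaff {n} (c : R) (y x : n.-tuple R) : n.-tuple R :=
  [tuple (c * tnth x i + tnth y i)%R | i < n].

Lemma measurable_vaff {n} (c : R) (y : n.-tuple R) :
  measurable_fun setT (vaff c y).
Proof.
apply/measurable_fun_tnthP => i; rewrite /comp.
under eq_fun do rewrite tnth_mktuple.
apply: measurable_funD => //; apply: measurable_funM => //; exact: measurable_tnth.
Qed.

Local Open Scope ereal_scope.

(** Tonelli's theorem for the inductive construction of Lebesgue measure on R^n:
    it reduces statements on R^n to dimension one. *)
Lemma ge0_integral_lebesgue_cons n (g : n.+1.-tuple R -> \bar R) :
  measurable_fun setT g -> (forall x, 0 <= g x) ->
  \int[lebesgue_Rn R n.+1]_x g x =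
  \int[lebesgue_measure]_a \int[lebesgue_Rn R n]_x g (vcons (a, x)).
Proof.
move=> mg g0.
rewrite -(fubini_tonelli1 (m1 := lebesgue_measure) (m2 := lebesgue_Rn R n) (g \o vcons))//=.
  by rewrite (@ge0_integral_pushforward _ _ _ _ _ _ measurable_vcons (lebesgue_measure \x lebesgue_Rn R n)).
exact: measurableT_comp mg measurable_vcons.
Qed.

Lemma ge0_integral_vaff {n} (c : R) (y : n.-tuple R) (g : n.-tuple R -> \bar R) :
  (0 < c)%R -> measurable_fun setT g -> (forall x, 0 <= g x) ->
  \int[lebesgue_Rn R n]_x g (vaff c y x) =
  (c ^- n)%:E * \int[lebesgue_Rn R n]_x g x.
Proof.
move=> c0; elim: n y g => [|n IH] y g mg g0.
  rewrite expr0 invr1 mul1e; apply: eq_integral => x _.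
  by rewrite (tuple0 x) (tuple0 (vaff _ _ _)).
have mgc a : measurable_fun setT (fun x : n.-tuple R => g (vcons (a, x))).
  apply: (measurableT_comp mg) => /=.
  apply: (measurable_cons (f := cst (a : measurableTypeR R))) => //.
  exact: measurable_id.
have mI : measurable_fun setT (fun a : measurableTypeR R => \int[lebesgue_Rn R n]_x g (vcons (a, x))).
  apply: (measurable_fun_fubini_tonelli_F (m2 := lebesgue_Rn R n) (g \o vcons)) => //=.
  exact: (measurableT_comp mg measurable_vcons).
rewrite ge0_integral_lebesgue_cons//; last first.
  exact: (measurableT_comp mg (measurable_vaff _ _)).
rewrite ge0_integral_lebesgue_cons//.
pose y' := [tuple of behead y].
under eq_integral => a _.
  have E x : vaff c y (vcons (a, x)) =
      vcons ((c * a + thead y)%R, vaff c y' x).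
    apply: eq_from_tnth => i; rewrite tnth_mktuple.
    case: (unliftP ord0 i) => [j ->|->].
      by rewrite !tnthS tnth_mktuple {1}(tuple_eta y) tnthS.
    by rewrite /= !tnth0.
  under eq_integral => x _ do rewrite E.
  rewrite (IH y' (fun x => g (vcons ((c * a + thead y)%R, x))))//.
  over.
rewrite ge0_integralZl//.
- rewrite (ge0_integral_affine c (thead y) (fun b => \int[lebesgue_Rn R n]_x g (vcons (b, x))))//.
    by rewrite muleA -EFinM exprSr invfM.
  by move=> a; exact: integral_ge0.
- exact: (measurableT_comp mI (measurable_affine c (thead y))).
- by move=> a _; exact: integral_ge0.
- by rewrite lee_fin invr_ge0 exprn_ge0 ?ltW.
Qed.
End vectors.

(** * Euclidean norm and volume of balls *)

Section euclid.
Context {R : realType} {n : nat}.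
Implicit Types x y z : n.-tuple R.
Local Notation mu := (lebesgue_Rn R n).

Lemma enorm_ge0 x : 0 <= enorm x. Proof. exact: sqrtr_ge0. Qed.

Lemma cauchy_schwarz_sum (a b : 'I_n -> R) :
  \sum_i a i * b i <= Num.sqrt (\sum_i a i ^+ 2) * Num.sqrt (\sum_i b i ^+ 2).
Proof.
set A := \sum_i a i ^+ 2; set B := \sum_i b i ^+ 2.
have A0 : 0 <= A by apply: sumr_ge0 => i _; exact: sqr_ge0.
have B0 : 0 <= B by apply: sumr_ge0 => i _; exact: sqr_ge0.
have z0 (c d : 'I_n -> R) : \sum_i c i ^+ 2 = 0 -> \sum_i c i * d i = 0.
  move=> C0; apply: big1 => i _.
  have /(_ i isT)/eqP := psumr_eq0P (fun i _ => sqr_ge0 (c i)) C0.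
  by rewrite sqrf_eq0 => /eqP ->; rewrite mul0r.
have [A00|An0] := eqVneq A 0.
  by rewrite (z0 a b)// mulr_ge0// sqrtr_ge0.
have [B00|Bn0] := eqVneq B 0.
  under eq_bigr do rewrite mulrC.
  by rewrite (z0 b a)// mulr_ge0// sqrtr_ge0.
set sA := Num.sqrt A; set sB := Num.sqrt B.
have sA0 : 0 < sA by rewrite sqrtr_gt0 lt_neqAle eq_sym An0.
have sB0 : 0 < sB by rewrite sqrtr_gt0 lt_neqAle eq_sym Bn0.
have : 0 <= \sum_i (sB * a i - sA * b i) ^+ 2.
  by apply: sumr_ge0 => i _; exact: sqr_ge0.
rewrite (eq_bigr (fun i => sB ^+ 2 * a i ^+ 2 + sA ^+ 2 * b i ^+ 2 -
    (2 * sA * sB) * (a i * b i))); last by move=> i _; ring.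
rewrite sumrB big_split/= -!mulr_sumr -/A -/B.
have <- : sA ^+ 2 = A by rewrite sqr_sqrtr.
have <- : sB ^+ 2 = B by rewrite sqr_sqrtr.
set S := \sum_i _ => h.
have : 0 <= (2 * sA * sB) * (sA * sB - S) by move: h; congr (_ <= _); ring.
by rewrite pmulr_rge0 ?mulr_gt0// subr_ge0.
Qed.

Lemma sqrt_sum_sqrD (a b : 'I_n -> R) :
  Num.sqrt (\sum_i (a i + b i) ^+ 2) <=
  Num.sqrt (\sum_i a i ^+ 2) + Num.sqrt (\sum_i b i ^+ 2).
Proof.
rewrite -[leRHS]ger0_norm ?addr_ge0 ?sqrtr_ge0// -sqrtr_sqr ler_wsqrtr//.
rewrite (eq_bigr (fun i => a i ^+ 2 + b i ^+ 2 + 2 * (a i * b i))); last first.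
  by move=> i _; ring.
rewrite big_split/= big_split/= -mulr_sumr sqrrD !sqr_sqrtr.
- by rewrite addrAC lerD2r lerD2l mulr_natl ler_pMn2r// cauchy_schwarz_sum.
- by apply: sumr_ge0 => i _; exact: sqr_ge0.
- by apply: sumr_ge0 => i _; exact: sqr_ge0.
Qed.

Lemma enorm_triangle y x z : enorm (vsub x z) <= enorm (vsub x y) + enorm (vsub y z).
Proof.
apply: le_trans (sqrt_sum_sqrD _ _).
rewrite le_eqVlt; apply/orP; left; apply/eqP; congr Num.sqrt.
by apply: eq_bigr => i _; rewrite !tnth_mktuple subrKA.
Qed.

Lemma enorm_vscale (c : R) x : enorm (vscale c x) = `|c| * enorm x.
Proof.
rewrite /enorm -sqrtr_sqr -sqrtrM ?sqr_ge0// mulr_sumr; congr Num.sqrt.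
by apply: eq_bigr => i _; rewrite tnth_mktuple exprMn.
Qed.

Lemma vsubv0 x : vsub x vzero = x.
Proof. by apply: eq_from_tnth => i; rewrite !tnth_mktuple subr0. Qed.

Lemma vscale0 x : vscale 0 x = vzero.
Proof. by apply: eq_from_tnth => i; rewrite !tnth_mktuple mul0r. Qed.

Lemma enorm0 : enorm (@vzero R n) = 0.
Proof. by rewrite -(vscale0 (@vzero R n)) enorm_vscale normr0 mul0r. Qed.

Lemma enormB x y : enorm (vsub x y) = enorm (vsub y x).
Proof.
congr Num.sqrt; apply: eq_bigr => i _.
by rewrite !tnth_mktuple -sqrrN opprB.
Qed.

Lemma ler_enorm_coord x i : `|tnth x i| <= enorm x.
Proof.
rewrite -sqrtr_sqr ler_wsqrtr// (bigD1 i)//= lerDl.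
by apply: sumr_ge0 => j _; exact: sqr_ge0.
Qed.

Lemma enorm_eq0 x : enorm x = 0 -> x = vzero.
Proof.
move=> x0; apply: eq_from_tnth => i; rewrite tnth_mktuple; apply/eqP.
by rewrite -normr_le0 -x0 ler_enorm_coord.
Qed.

Lemma measurable_vsubl y : measurable_fun setT (fun x => vsub x y).
Proof.
apply/measurable_fun_tnthP => i; rewrite /comp.
under eq_fun do rewrite tnth_mktuple.
by apply: measurable_funB => //; exact: measurable_tnth.
Qed.

Local Open Scope ereal_scope.

Lemma lebesgue_Rn_vaff (c : R) y (A : set (n.-tuple R)) :
  (0 < c)%R -> measurable A -> mu (vaff c y @^-1` A) = (c ^- n)%:E * mu A.
Proof.
move=> c0 mA.
have mv : measurable (vaff c y @^-1` A).
  by rewrite -[X in measurable X]setTI; exact: measurable_vaff.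
have E B : measurable B -> mu B = \int[mu]_x (\1_B x)%:E.
  by move=> mB; rewrite integral_indic// setIT.
rewrite !E// -(ge0_integral_vaff c y (fun x => (\1_A x)%:E))//.
by apply/measurable_EFinP; exact: measurable_indic.
Qed.

Lemma ge0_integral_translate y (g : n.-tuple R -> \bar R) :
  measurable_fun setT g -> (forall x, 0 <= g x) ->
  \int[mu]_x g (vsub x y) = \int[mu]_x g x.
Proof.
move=> mg g0.
rewrite -[RHS]mul1e -[in X in X * _](invr1 R) -(expr1n R n).
rewrite -(ge0_integral_vaff 1 (vscale (-1) y))//.
apply: eq_integral => x _; congr g; apply: eq_from_tnth => i.
by rewrite !tnth_mktuple mul1r mulN1r.
Qed.

Lemma lebesgue_Rn_eball x (r : R) : (0 < r)%R ->
  mu (eball x r) = (r ^+ n)%:E * mu (eball vzero 1).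
Proof.
move=> r0.
rewrite -[r in LHS]invrK -[r in RHS]invrK.
set s := (r^-1)%R; have s0 : (0 < s)%R by rewrite invr_gt0.
rewrite exprVn -(lebesgue_Rn_vaff s (vscale (- s) x))//; last exact: measurable_eball.
congr (mu _); apply/seteqP; split => z /=; rewrite /eball/= vsubv0.
all: have -> : vaff s (vscale (- s) x) z = vscale s (vsub z x)
  by apply: eq_from_tnth => i; rewrite !tnth_mktuple; ring.
all: by rewrite enorm_vscale gtr0_norm// -ler_pdivlMl// mulr1.
Qed.

(** The unit ball is contained in the cube of side 2. *)
Lemma lebesgue_Rn_ball1_lty : mu (eball vzero 1) < +oo.
Proof.
have mI : measurable (`[(-1)%R, 1%R]%classic : set R) by [].
apply: (@le_lt_trans _ _ (mu [set x | forall i, `[(-1)%R, 1%R]%classic (tnth x i)])).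
  apply: le_measure; rewrite ?inE//.
  - exact: measurable_eball.
  - rewrite (_ : mkset _ = \bigcap_(i in [set: 'I_n])
      ((fun x => tnth x i) @^-1` `[(-1)%R, 1%R]%classic)).
      apply: fin_bigcap_measurable => // i _.
      by rewrite -[X in measurable X]setTI; exact: measurable_tnth.
    by apply/seteqP; split => x /= Ax i; first move=> _; apply: Ax.
  - move=> x; rewrite /eball/= vsubv0 => x1 i; rewrite /= in_itv/= -ler_norml.
    exact: le_trans (ler_enorm_coord _ _) x1.
rewrite (@lebesgue_Rn_box R n (fun=> `[(-1)%R, 1%R]%classic))//.
rewrite (eq_bigr (fun=> (2%R)%:E)); last first.
  move=> i _; rewrite lebesgue_measure_itv/= lte_fin ifT; last lra.
  by rewrite -EFinB; congr EFin; lra.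
by rewrite prodEFin ltry.
Qed.

(** The unit ball contains the cube of half-side 1/(n+1). *)
Lemma lebesgue_Rn_ball1_gt0 : 0 < mu (eball vzero 1).
Proof.
set c : R := (n.+1%:R^-1)%R.
have c0 : (0 < c)%R by rewrite invr_gt0.
apply: (@lt_le_trans _ _ (mu [set x | forall i, `[(- c)%R, c]%classic (tnth x i)])).
  rewrite (@lebesgue_Rn_box R n (fun=> `[(- c)%R, c]%classic))//.
  rewrite (eq_bigr (fun=> (2 * c)%:E)); last first.
    move=> i _; rewrite lebesgue_measure_itv/= lte_fin ifT; last lra.
    by rewrite -EFinB; congr EFin; lra.
  by rewrite prodEFin lte_fin; apply: prodr_gt0 => i _; lra.
apply: le_measure; rewrite ?inE//; last 2 first.
- exact: measurable_eball.
- move=> x /= xc; rewrite /eball/= vsubv0 -[leRHS]sqrtr1 ler_wsqrtr//.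
  apply: (@le_trans _ _ (\sum_(i < n) c ^+ 2)%R).
    apply: ler_sum => i _; have := xc i; rewrite /= in_itv/= -ler_norml => h.
    by rewrite -(real_normK (num_real (tnth x i))) lerXn2r ?nnegrE ?(ltW c0).
  rewrite sumr_const card_ord -mulr_natl /c exprVn ler_pdivrMr ?exprn_gt0// mul1r.
  by rewrite -natrX ler_nat (leq_trans (leqnSn n))// -mulnn leq_pmulr.
rewrite (_ : mkset _ = \bigcap_(i in [set: 'I_n])
  ((fun x => tnth x i) @^-1` `[(-c)%R, c]%classic)).
  apply: fin_bigcap_measurable => // i _.
  by rewrite -[X in measurable X]setTI; exact: measurable_tnth.
by apply/seteqP; split => x /= Ax i; first move=> _; apply: Ax.
Qed.

Definition vol1 : R := fine (mu (eball vzero 1)).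

Lemma vol1_gt0 : (0 < vol1)%R.
Proof. by rewrite fine_gt0// lebesgue_Rn_ball1_gt0 lebesgue_Rn_ball1_lty. Qed.

Lemma lebesgue_Rn_ball x (r : R) : (0 < r)%R -> mu (eball x r) = (r ^+ n * vol1)%:E.
Proof.
move=> r0; rewrite lebesgue_Rn_eball// EFinM fineK// ge0_fin_numE//.
exact: lebesgue_Rn_ball1_lty.
Qed.

Lemma lebesgue_Rn_hyperplane (i : 'I_n) (c : R) : mu [set x | tnth x i = c] = 0.
Proof.
rewrite (_ : mkset _ =
    [set x | forall j, (if j == i then [set c] else setT) (tnth x j)]); last first.
  apply/seteqP; split => x /=.
    by move=> xc j; case: eqP => // ->.
  by move=> /(_ i); rewrite eqxx.
rewrite (@lebesgue_Rn_box R n (fun j => if j == i then [set c] else setT)); last by move=> j; case: ifP.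
by rewrite (bigD1 i)//= eqxx lebesgue_measure_set1 mul0e.
Qed.

Lemma measurable_coord (i : 'I_n) (A : set (measurableTypeR R)) :
  measurable A -> measurable [set x : n.-tuple R | A (tnth x i)].
Proof.
move=> mA; rewrite -[X in measurable X]setTI.
exact: (@measurable_tnth _ (measurableTypeR R) n i).
Qed.

Lemma measurable_set1_Rn y : measurable [set y].
Proof.
rewrite (_ : [set y] = \bigcap_(i in [set: 'I_n]) [set x | tnth x i = tnth y i]).
  by apply: fin_bigcap_measurable => // i _; exact: (measurable_coord i [set _]).
apply/seteqP; split => x /=; first by move=> ->.
by move=> xy; apply: eq_from_tnth => i; exact: xy.
Qed.

Lemma lebesgue_Rn_set1 y : (0 < n)%N -> mu [set y] = 0.
Proof.
move=> n0; apply: (@subset_measure0 _ _ _ _ _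
  [set x | tnth x (Ordinal n0) = tnth y (Ordinal n0)]).
- exact: measurable_set1_Rn.
- exact: (measurable_coord _ [set _]).
- by move=> x ->.
- exact: lebesgue_Rn_hyperplane.
Qed.

End euclid.

(** * Integral of a power weight over a ball *)

Lemma measurable_nneseries (d : measure_display) (T : measurableType d)
    (R : realType) (h : nat -> T -> \bar R) :
  (forall k x, 0 <= h k x)%E -> (forall k, measurable_fun setT (h k)) ->
  measurable_fun setT (fun x => \sum_(0 <= k <oo) h k x)%E.
Proof.
by move=> h0 mh; exact: (@ge0_emeasurable_sum _ _ _ setT h xpredT).
Qed.

Lemma nneseries_ge_term (R : realType) (u : nat -> \bar R) j :
  (forall k, 0 <= u k)%E -> (u j <= \sum_(0 <= k <oo) u k)%E.
Proof.
move=> u0; apply: le_trans (nneseries_lim_ge j.+1 _) => //.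
by rewrite big_nat_recr//= leeDr// sume_ge0.
Qed.

Section weight.
Context {R : realType}.

Lemma le_powR_npos (b x y : R) : b <= 0 -> 0 < x -> x <= y -> y `^ b <= x `^ b.
Proof.
move=> b0 x0 xy; have y0 := lt_le_trans x0 xy.
rewrite -[b]opprK (powRN y) (powRN x) lef_pV2 ?posrE ?powR_gt0//.
by apply: ge0_ler_powR; rewrite ?nnegrE ?oppr_ge0// ltW.
Qed.

Lemma dyadic_scale (x rho : R) : 0 < x -> x <= rho ->
  exists j, rho / 2 ^+ j.+1 < x <= rho / 2 ^+ j.
Proof.
move=> x0 xr.
have r0 := lt_le_trans x0 xr.
have [j0 hj0] : exists j, rho / 2 ^+ j.+1 < x.
  have [k hk] : exists k : nat, rho / x < k%:R.
    by exists (Num.bound (rho / x)); apply: archi_boundP; rewrite ltW// divr_gt0.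
  exists k; rewrite ltr_pdivrMr ?exprn_gt0// -ltr_pdivrMl// mulrC (lt_le_trans hk)//.
  by rewrite -natrX ler_nat ltnW// (ltn_trans (ltn_expl k (ltnSn 1)))// ltn_exp2l.
have hP : exists j, rho / 2 ^+ j.+1 < x by exists j0.
exists (ex_minn hP); case: ex_minnP => [[|m]] -> min /=.
  by rewrite expr0 divr1.
by rewrite leNgt; apply/negP => /min; rewrite ltnn.
Qed.

Context {n : nat}.
Local Notation mu := (lebesgue_Rn R n).
Local Open Scope ereal_scope.

Lemma measurable_weight (b : R) :
  measurable_fun setT (fun x : n.-tuple R => (enorm x `^ b)%:E).
Proof.
apply/measurable_EFinP; apply: (measurableT_comp (measurable_powR b)); exact: measurable_enorm.
Qed.

Lemma geometric_nneseries_le (K z : R) : (0 <= K)%R -> (0 <= z)%R -> (z < 1)%R ->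
  \sum_(0 <= j <oo) (K * z ^+ j)%:E <= (K / (1 - z))%:E.
Proof.
move=> K0 z0 z1.
apply: lime_le; first by apply: is_cvg_nneseries => j _ _; rewrite lee_fin mulr_ge0// exprn_ge0.
near=> N; rewrite sumEFin lee_fin.
have := congr1 (fun f : R^nat => f N) (geometric_seriesE K (negbT (lt_eqF z1))).
rewrite /series/= /geometric/= => ->.
rewrite ler_pM2r ?invr_gt0 ?subr_gt0// ler_piMr// lerBlDr lerDl exprn_ge0//.
Unshelve. all: by end_near. Qed.

(** For a ball centred at the origin the weight is summed over dyadic shells,
    where it is comparable to a constant; the series converges because n + b > 0.
    In any other ball of the same radius, a point either lies in the centred one
    or carries a weight of at most rho^b. *)
Lemma integral_weight_ball (b : R) : (- n%:R < b)%R -> (b <= 0)%R ->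
  exists2 C : R, (0 < C)%R & forall (x0 : n.-tuple R) (rho : R), (0 < rho)%R ->
    \int[mu]_(x in eball x0 rho) (enorm x `^ b)%:E <= (C * rho `^ (n%:R + b))%:E.
Proof.
move=> nb b0.
have nb0 : (0 < n%:R + b)%R by rewrite -ltrBlDl sub0r.
set w := vol1 (R := R) (n := n); have w0 : (0 < w)%R := vol1_gt0.
set z : R := (2^-1 `^ (n%:R + b))%R.
have z0 : (0 < z)%R by rewrite powR_gt0.
have z1 : (z < 1)%R.
  apply: (@lt_le_trans _ _ (1 `^ (n%:R + b))%R); last by rewrite powR1.
  apply: gt0_ltr_powR; rewrite ?nnegrE//; lra.
set C1 : R := (2^-1 `^ b * w / (1 - z))%R.
have C10 : (0 < C1)%R by rewrite divr_gt0 ?subr_gt0// mulr_gt0// powR_gt0.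
have powE (r : R) : (0 < r -> r `^ b * r ^+ n = r `^ (n%:R + b))%R.
  by move=> r0; rewrite -powR_mulrn ?ltW// -powRD ?[(b + _)%R]addrC// gt_eqF.
have H0 rho : (0 < rho)%R ->
    \int[mu]_(x in eball vzero rho) (enorm x `^ b)%:E <= (C1 * rho `^ (n%:R + b))%:E.
  move=> r0.
  pose r j : R := (rho / 2 ^+ j)%R.
  have rp j : (0 < r j)%R by rewrite divr_gt0// exprn_gt0.
  have m1 j : measurable_fun setT (fun x : n.-tuple R =>
     ((2^-1 * r j) `^ b * \1_(eball vzero (r j)) x)%:E).
    apply/measurable_EFinP; apply: measurable_funM => //.
    by apply: measurable_indic; exact: measurable_eball.
  have p1 j (x : n.-tuple R) : 0 <= ((2^-1 * r j) `^ b * \1_(eball vzero (r j)) x)%:E.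
    by rewrite lee_fin mulr_ge0// powR_ge0.
  have mW := (measurable_restrictT (fun x : n.-tuple R => (enorm x `^ b)%:E)
    (measurable_eball vzero rho)).1 (measurable_funTS (measurable_weight b)).
  have mS := measurable_nneseries _ _ _ _ p1 m1.
  apply: (@le_trans _ _ (\int[mu]_x \sum_(0 <= j <oo)
     ((2^-1 * r j) `^ b * \1_(eball vzero (r j)) x)%:E)).
    rewrite integral_mkcond; apply: ge0_le_integral => //.
    - by move=> x _; rewrite patchE; case: ifP => // _; rewrite lee_fin powR_ge0.
    - move=> x _; rewrite patchE; case: ifPn => [/set_mem|_]; last first.
        by apply: nneseries_ge0.
      rewrite /eball/= vsubv0 => xr.
      have [j hj] : exists j, (enorm x `^ b)%:E <= ((2^-1 * r j) `^ b * \1_(eball vzero (r j)) x)%:E.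
        have [x00|xn0] := eqVneq (enorm x) 0%R.
          exists 0%N; rewrite indicE mem_set/= ?mulr1; last first.
            by rewrite /eball/= vsubv0 x00 ltW.
          rewrite x00 lee_fin; have [->|bn0] := eqVneq b 0%R; first by rewrite !powRr0.
          by rewrite powR0// powR_ge0.
        have xp : (0 < enorm x)%R by rewrite lt_neqAle eq_sym xn0 enorm_ge0.
        have [j /andP[j1 j2]] := dyadic_scale _ _ xp xr.
        exists j; rewrite indicE mem_set/= ?mulr1 ?lee_fin; last first.
          by rewrite /eball/= vsubv0.
        apply: le_powR_npos => //; first by rewrite mulr_gt0.
        apply: ltW; apply: le_lt_trans j1; rewrite /r exprS invfM. 
        by rewrite mulrCA.
      apply: (le_trans hj).
      exact: (nneseries_ge_term _ (fun j => ((2^-1 * r j) `^ b * \1_(eball vzero (r j)) x)%:E)).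
  rewrite integral_nneseries//.
  rewrite (eq_eseriesr (g := fun j => (2^-1 `^ b * w * rho `^ (n%:R + b) * z ^+ j)%:E)); last first.
    move=> j _.
    under eq_integral do rewrite EFinM.
    rewrite ge0_integralZl//; last 2 first.
    - by apply/measurable_EFinP/measurable_indic; exact: measurable_eball.
    - by rewrite lee_fin powR_ge0.
    rewrite integral_indic//; last exact: measurable_eball.
    rewrite setIT [X in _ * X](lebesgue_Rn_ball vzero (r j) (rp j)) -EFinM; congr EFin.
    have zj : ((2^-1 ^+ j) `^ (n%:R + b) = z ^+ j)%R.
      rewrite -[(2^-1 ^+ j)%R]powR_mulrn ?invr_ge0// -powRrM mulrC powRrM -/z powR_mulrn//.
      exact: ltW.
    rewrite powRM ?invr_ge0 ?(ltW (rp j))// mulrA -[X in (X * _)%R]mulrA powE//.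
    rewrite /r -exprVn powRM ?(ltW r0) ?exprn_ge0 ?invr_ge0// zj -/w; ring.
  apply: (le_trans (geometric_nneseries_le _ _ _ _ _)) => //.
  - by rewrite !mulr_ge0 ?powR_ge0 ?ltW.
  - exact: ltW.
  - rewrite lee_fin le_eqVlt; apply/orP; left; apply/eqP; rewrite /C1; ring.
exists (C1 + w)%R; first by rewrite addr_gt0.
move=> x0 rho r0.
rewrite mulrDl EFinD.
apply: (@le_trans _ _ (\int[mu]_(x in eball vzero rho) (enorm x `^ b)%:E +
   \int[mu]_(x in eball x0 rho) (rho `^ b)%:E)); last first.
  apply: leeD; first exact: H0.
  rewrite integral_cst; last exact: measurable_eball.
  rewrite [X in _ * X <= _](lebesgue_Rn_ball x0 rho r0) -EFinM lee_fin -powE// -/w.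
  by rewrite le_eqVlt; apply/orP; left; apply/eqP; ring.
have mE x rr := @measurable_eball R n x rr.
have mW x rr := (measurable_restrictT (fun x : n.-tuple R => (enorm x `^ b)%:E)
    (mE x rr)).1 (measurable_funTS (measurable_weight b)).
have mC x rr := (measurable_restrictT (fun x : n.-tuple R => (rho `^ b)%:E)
    (mE x rr)).1 (measurable_funTS (measurable_cst _)).
have pW x rr y : 0 <= ((fun x : n.-tuple R => (enorm x `^ b)%:E) \_ (eball x rr)) y.
  by rewrite patchE; case: ifP => // _; rewrite lee_fin powR_ge0.
have pC x rr y : 0 <= ((fun x : n.-tuple R => (rho `^ b)%:E) \_ (eball x rr)) y.
  by rewrite patchE; case: ifP => // _; rewrite lee_fin powR_ge0.
rewrite integral_mkcond [X in X + _]integral_mkcond [X in _ + X]integral_mkcond.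
rewrite -ge0_integralD//.
apply: ge0_le_integral => //; first exact: emeasurable_funD.
move=> x _; rewrite patchE; case: ifPn => [xB|]; last by rewrite adde_ge0.
have [xr|xr] := leP (enorm x) rho.
  rewrite [X in X + _]patchE mem_set; last by rewrite /eball/= vsubv0.
  by rewrite leeDl.
rewrite [X in _ + X]patchE xB; apply: (@le_trans _ _ (rho `^ b)%:E); last by rewrite leeDr.
by rewrite lee_fin le_powR_npos// ltW.
Qed.

End weight.

(** * Surface measure of spherical caps *)

Section sphere.
Context {R : realType} {n : nat}.
Local Notation Rn := (n.-tuple R).
Local Notation mu := (lebesgue_Rn R n).
Local Notation sigma := (@sphere_measure R n).
Local Open Scope ereal_scope.

Lemma sphere_measureE (A : set Rn) :
  sigma A = (vol1 (R := R) (n := n))^-1%:E * mu (vdirection @^-1` A `&` eball vzero 1).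
Proof. by []. Qed.

Lemma sphere_measureT : sigma setT = 1.
Proof.
rewrite sphere_measureE setTI lebesgue_Rn_ball// expr1n mul1r -EFinM mulVf//.
by rewrite gt_eqF// vol1_gt0.
Qed.

Lemma sphere_measure_finite : fin_num_fun sigma.
Proof.
move=> A mA; rewrite ge0_fin_numE//; apply: (@le_lt_trans _ _ (sigma setT)).
  by apply: le_measure; rewrite ?inE//; exact: measurableT.
by rewrite sphere_measureT ltry.
Qed.

HB.instance Definition _ := Measure_isFinite.Build _ _ _ sigma sphere_measure_finite.

Lemma measurable_usphere : measurable (@usphere R n).
Proof.
rewrite -[X in measurable X]setTI.
have m : measurable_fun setT (@enorm R n) := measurable_enorm.
exact: (m measurableT [set 1%R] (measurable_set1 1%R)).
Qed.

Lemma sphere_measureC (n0 : (0 < n)%N) : sigma (~` usphere) = 0.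
Proof.
rewrite sphere_measureE; apply/eqP; rewrite mule_eq0; apply/orP; right; apply/eqP.
apply: (@subset_measure0 _ _ _ _ _ [set vzero]).
- apply: measurableI; last exact: measurable_eball.
  rewrite -[X in measurable X]setTI; apply: measurable_vdirection => //.
  by apply: measurableC; exact: measurable_usphere.
- exact: measurable_set1_Rn.
- move=> x [/= xd _]; apply: enorm_eq0; apply: contra_notP xd => /eqP x0.
  rewrite /usphere/= /vdirection enorm_vscale normfV ger0_norm ?enorm_ge0//.
  by rewrite mulVf.
- exact: lebesgue_Rn_set1.
Qed.

Lemma sphere_measure_usphere (n0 : (0 < n)%N) : sigma usphere = 1.
Proof.
rewrite -sphere_measureT -(setvU (@usphere R n)) measureU//.
- by rewrite [X in X + _]sphere_measureC// add0e.
- by apply: measurableC; exact: measurable_usphere.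
- exact: measurable_usphere.
- by rewrite setICl.
Qed.

(** The directions w with x - t w in the ball of radius r lie in a cap of radius
    at most 2d, d = r/t.  The part of the unit ball over this cap is covered by
    O(1/d) balls of radius 3d centred on a ray, hence has volume O(d^(n-1)).
    When t <= r the bound is trivial since r/(r+t) >= 1/2. *)
Lemma sphere_cap_le (x x0 : Rn) (t r : R) : (0 < n)%N -> (0 <= t)%R -> (0 < r)%R ->
  sigma (usphere `&` [set w | eball x0 r (vsub x (vscale t w))])
    <= (6 ^+ n * (r / (r + t)) ^+ n.-1)%:E.
Proof.
move=> n0 t0 r0; set A := _ `&` _.
have mA : measurable A.
  apply: measurableI; first exact: measurable_usphere.
  have mv : measurable_fun setT (fun w : Rn => vsub x (vscale t w)).
    apply/measurable_fun_tnthP => i; rewrite /comp.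
    under eq_fun do rewrite !tnth_mktuple.
    apply: measurable_funB => //; apply: measurable_funM => //.
    exact: measurable_tnth.
  by rewrite -[X in measurable X]setTI; apply: mv => //; exact: measurable_eball.
have rt0 : (0 < r + t)%R by rewrite ltr_wpDr.
have E6 : (6 ^+ n = 2 * 3 ^+ n * 2 ^+ n.-1 :> R)%R.
  have e2 : (2 ^+ n = 2 * 2 ^+ n.-1 :> R)%R by rewrite -exprS prednK.
  by rewrite (_ : 6 = 2 * 3)%R ?exprMn ?e2; ring.
have [tr|rt] := leP t r.
  apply: (@le_trans _ _ (sigma setT)).
    by apply: le_measure; rewrite ?inE//; exact: measurableT.
  rewrite sphere_measureT lee_fin.
  have h : (2^-1 <= r / (r + t))%R by rewrite ler_pdivlMr//; lra.
  apply: (@le_trans _ _ (6 ^+ n * 2^-1 ^+ n.-1)%R).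
    rewrite E6 -[leRHS]mulrA -exprMn mulfV// expr1n mulr1.
    by rewrite -[leLHS]mulr1 ler_pM// ?exprn_ege1//; lra.
  by rewrite ler_pM2l ?exprn_gt0// lerXn2r ?nnegrE ?divr_ge0 ?(ltW r0) ?(ltW rt0)//.
have [->|/set0P[w0 Aw0]] := eqVneq A set0.
  by rewrite measure0 lee_fin mulr_ge0// exprn_ge0// divr_ge0// ltW.
have {t0} t0 : (0 < t)%R by exact: lt_trans r0 rt.
set d := (r / t)%R; have d0 : (0 < d)%R by rewrite divr_gt0.
have d1 : (d < 1)%R by rewrite ltr_pdivrMr// mul1r.
(* centres j d w0 of the covering balls, for 0 <= j <= 1/d *)
pose J := Num.truncn d^-1%R.
have dist w : A w -> (enorm (vsub w w0) <= 2 * d)%R.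
  move=> Aw; have [[_ h1] [_ h2]] := (Aw, Aw0).
  have := enorm_triangle x0 (vsub x (vscale t w)) (vsub x (vscale t w0)).
  have -> : vsub (vsub x (vscale t w)) (vsub x (vscale t w0)) = vscale (- t) (vsub w w0).
    by apply: eq_from_tnth => i; rewrite !tnth_mktuple; ring.
  rewrite enorm_vscale normrN gtr0_norm// [X in (_ <= _ + X)%R]enormB => h.
  have {h1 h2 h}h : (t * enorm (vsub w w0) <= 2 * r)%R.
    by rewrite (le_trans h)// mulr_natl mulr2n lerD.
  by rewrite /d mulrA ler_pdivlMr// mulrC.
have cover : vdirection @^-1` A `&` eball vzero 1 `<=`
    \big[setU/set0]_(j < J.+1) eball (vscale (j%:R * d)%R w0) (3 * d)%R.
  rewrite -(bigcup_mkord _ (fun j => eball (vscale (j%:R * d)%R w0) (3 * d)%R)).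
  move=> z [Az]; rewrite {1}/eball/= vsubv0 => z1.
  have w01 : enorm w0 = 1%R by case: Aw0.
  set w := vdirection z in Az.
  have zn0 : enorm z != 0%R.
    apply/eqP => z0; case: Az; rewrite /usphere/= /w /vdirection z0 invr0 vscale0 enorm0.
    by move=> /eqP; rewrite eq_sym oner_eq0.
  have zE : z = vscale (enorm z) w.
    by apply: eq_from_tnth => i; rewrite !tnth_mktuple mulVKf.
  pose j := Num.truncn (enorm z / d)%R.
  have /truncn_itv/andP[j1 j2] : (0 <= enorm z / d)%R by rewrite divr_ge0 ?enorm_ge0// ltW.
  exists j => /=.
    rewrite ltnS; apply: le_truncn; rewrite -[leRHS]mul1r ler_pM2r ?invr_gt0//.
  apply: (le_trans (enorm_triangle (vscale (enorm z) w0) _ _)).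
  have -> : vsub z (vscale (enorm z) w0) = vscale (enorm z) (vsub w w0).
    by rewrite {1}zE; apply: eq_from_tnth => i; rewrite !tnth_mktuple; ring.
  have -> : vsub (vscale (enorm z) w0) (vscale (j%:R * d)%R w0) =
      vscale (enorm z - j%:R * d)%R w0.
    by apply: eq_from_tnth => i; rewrite !tnth_mktuple; ring.
  rewrite !enorm_vscale w01 mulr1 (ger0_norm (enorm_ge0 _)).
  have h1 : (enorm z * enorm (vsub w w0) <= 2 * d)%R.
    rewrite -[leRHS]mul1r ler_pM ?enorm_ge0//; exact: dist.
  have h2 : (`|enorm z - j%:R * d| <= d)%R.
    move: j1 j2; rewrite -/j ler_pdivlMr// ltr_pdivrMr// => j1 j2.
    rewrite ger0_norm ?subr_ge0// lerBlDr (le_trans (ltW j2))//.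
    by rewrite -natr1 mulrDl mul1r addrC.
  by rewrite (_ : 3 * d = 2 * d + d)%R ?lerD//; ring.
rewrite sphere_measureE.
have mD : measurable (vdirection @^-1` A `&` eball vzero 1).
  apply: measurableI; last exact: measurable_eball.
  by rewrite -[X in measurable X]setTI; exact: measurable_vdirection.
apply: (@le_trans _ _ ((vol1 (R := R) (n := n))^-1%:E *
    \sum_(j < J.+1) mu (eball (vscale (j%:R * d)%R w0) (3 * d)%R))).
  apply: lee_wpmul2l; first by rewrite lee_fin invr_ge0 ltW// vol1_gt0.
  apply: (@content_subadditive _ _ _ mu _
    (fun j => eball (vscale (j%:R * d)%R w0) (3 * d)%R) J.+1 _ mD cover).
  by move=> j _; exact: measurable_eball.
rewrite (eq_bigr (fun=> ((3 * d) ^+ n * vol1 (R := R) (n := n))%:E)); last first.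
  by move=> j _; rewrite lebesgue_Rn_ball// mulr_gt0.
rewrite sumEFin -EFinM lee_fin sumr_const card_ord -[(_ *+ J.+1)%R]mulr_natl.
rewrite mulrCA [X in (_ * X <= _)%R]mulrC mulfK ?gt_eqF ?vol1_gt0//.
have J2 : (J.+1%:R <= 2 / d)%R.
  rewrite -natr1 mulr_natl mulr2n lerD//; last by rewrite invf_ge1// ltW.
  by rewrite truncn_le invr_ge0 ltW.
apply: (@le_trans _ _ (2 / d * (3 * d) ^+ n)%R).
  by rewrite ler_pM2r// exprn_gt0// mulr_gt0.
have dn : (d ^+ n = d * d ^+ n.-1)%R by rewrite -exprS prednK.
rewrite exprMn dn E6.
have -> : (2 / d * (3 ^+ n * (d * d ^+ n.-1)) = 2 * 3 ^+ n * d ^+ n.-1)%R.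
  by have dn0 := lt0r_neq0 d0; field.
rewrite -[leRHS]mulrA ler_pM2l ?mulr_gt0 ?exprn_gt0// -exprMn lerXn2r ?nnegrE//.
- exact: ltW.
- by rewrite mulr_ge0// divr_ge0// ltW.
rewrite /d ler_pdivrMr// mulrA -[leRHS]mulrAC ler_pdivlMr//.
have : (r * r <= r * t)%R by rewrite ler_pM2l// ltW.
lra.
Qed.

End sphere.

(** * Spherical means of nonnegative functions *)

Section cauchy_schwarz.
Context {d : measure_display} {T : measurableType d} {R : realType}.
Variable m : {measure set T -> \bar R}.
Local Open Scope ereal_scope.

(** Cauchy-Schwarz up to a factor 4, for a function supported in A: integrate
    h <= l 1_A + h^2 / l, and optimise over l. *)
Lemma integral_sqr_le (D A : set T) (h : T -> R) (c : R) :
  measurable D -> measurable A -> measurable_fun setT h -> (forall x, 0 <= h x)%R ->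
  (forall x, D x -> ~ A x -> h x = 0%R) -> (0 < c)%R -> m (D `&` A) <= c%:E ->
  (\int[m]_(x in D) (h x)%:E) `^ 2 <= (4 * c)%:E * \int[m]_(x in D) (h x ^+ 2)%:E.
Proof.
move=> mD mA mh h0 hA c0 mc.
set b := \int[m]_(x in D) (h x ^+ 2)%:E.
have b0 : 0 <= b by apply: integral_ge0 => x _; rewrite lee_fin sqr_ge0.
have mh2 : measurable_fun setT (fun x => h x ^+ 2)%R by exact: measurable_funX.
have key (l : R) : (0 < l)%R -> \int[m]_(x in D) (h x)%:E <= (l * c)%:E + (l^-1)%:E * b.
  move=> l0.
  have m1 : measurable_fun D (fun x => (l%:E * (\1_A x)%:E)).
    by apply: measurable_funTS; apply/measurable_EFinP; apply: measurable_funM => //.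
  have m2 : measurable_fun D (fun x => (l^-1%:E * (h x ^+ 2)%:E)).
    by apply: measurable_funTS; apply/measurable_EFinP; apply: measurable_funM => //.
  apply: (@le_trans _ _ (\int[m]_(x in D) (l%:E * (\1_A x)%:E + l^-1%:E * (h x ^+ 2)%:E))).
    apply: ge0_le_integral => //.
    - by move=> x _; rewrite lee_fin.
    - by apply/measurable_EFinP; exact: measurable_funTS.
    - exact: emeasurable_funD.
    - move=> x Dx; rewrite -!EFinM -EFinD lee_fin indicE.
      have [Ax|/negP nAx] := boolP (x \in A).
        rewrite mulr1.
        have : (0 <= l^-1 * ((h x - l) ^+ 2 + l * h x))%R.
          by rewrite mulr_ge0 ?invr_ge0 ?(ltW l0)// addr_ge0 ?sqr_ge0// mulr_ge0// ltW.
        rewrite -subr_ge0; congr (_ <= _)%R; field; exact: lt0r_neq0.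
      by rewrite hA//; [rewrite mulr0 expr0n/= mulr0 addr0|move=> Ax; apply: nAx; rewrite inE].
  rewrite ge0_integralD//; first last.
  - by move=> x _; rewrite lee_fin mulr_ge0 ?invr_ge0 ?sqr_ge0// ltW.
  - by move=> x _; rewrite lee_fin mulr_ge0// ltW.
  have mi : measurable_fun D (fun x => (\1_A x : R)%:E).
    by apply: measurable_funTS; apply/measurable_EFinP; exact: measurable_indic.
  have mq : measurable_fun D (fun x => (h x ^+ 2)%:E).
    by apply: measurable_funTS; apply/measurable_EFinP.
  have -> : \int[m]_(x in D) (l%:E * (\1_A x)%:E) = l%:E * \int[m]_(x in D) (\1_A x)%:E.
    by apply: ge0_integralZl => //; rewrite lee_fin ltW.
  have -> : \int[m]_(x in D) (l^-1%:E * (h x ^+ 2)%:E) = l^-1%:E * b.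
    by apply: ge0_integralZl => //; [move=> x _; rewrite lee_fin sqr_ge0|rewrite lee_fin invr_ge0 ltW].
  rewrite leeD2r// EFinM lee_pmul2l ?lte_fin//.
  by rewrite integral_indic// setIC.
have [bfin|] := ltP b +oo; last first.
  by rewrite leye_eq => /eqP ->; rewrite gt0_muley ?leey// lte_fin mulr_gt0.
move: (b) b0 bfin key => [{}b| |]// b0 _ key.
rewrite lee_fin in b0.
have I0 : 0 <= \int[m]_(x in D) (h x)%:E.
  by apply: integral_ge0 => x _; rewrite lee_fin.
have : \int[m]_(x in D) (h x)%:E < +oo.
  by apply: le_lt_trans (key 1%R ltr01) _; rewrite -EFinM -EFinD ltry.
move: (\int[m]_(x in D) (h x)%:E) I0 key => [y| |]// y0 key _.
rewrite lee_fin in y0.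
rewrite poweR_EFin -EFinM lee_fin (@powR_mulrn _ _ 2)//.
have {}key l : (0 < l -> y <= l * c + l^-1 * b)%R by move=> /key; rewrite lee_fin.
have [b00|bn0] := eqVneq b 0%R.
  suff yl : (y <= 0)%R.
    have -> : y = 0%R by apply: le_anti; rewrite yl y0.
    by rewrite b00 mulr0 expr0n.
  apply/ler_addgt0Pr => e e0; rewrite add0r.
  have := key (e / c)%R; rewrite b00 mulr0 addr0 divfK ?gt_eqF//; apply.
  exact: divr_gt0.
have bp : (0 < b)%R by rewrite lt_neqAle eq_sym bn0.
(* the optimal value of l *)
set s := Num.sqrt (b / c)%R.
have s0 : (0 < s)%R by rewrite sqrtr_gt0 divr_gt0.
have bE : (b = s ^+ 2 * c)%R by rewrite sqr_sqrtr ?divfK ?gt_eqF// divr_ge0// ltW.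
have := key s s0; rewrite bE.
have -> : (s * c + s^-1 * (s ^+ 2 * c) = 2 * s * c)%R by field; exact: lt0r_neq0.
move=> ys.
have -> : (4 * c * (s ^+ 2 * c) = (2 * s * c) ^+ 2)%R by ring.
by rewrite lerXn2r// nnegrE// !mulr_ge0// ltW.
Qed.

End cauchy_schwarz.

Section sph.
Context {R : realType} {n : nat}.
Local Notation Rn := (n.-tuple R).
Local Notation mu := (lebesgue_Rn R n).
Local Notation sigma := (@sphere_measure R n).
Local Open Scope ereal_scope.

(** The spherical mean with values in [0, +oo], for which Tonelli's theorem holds
    without integrability assumptions. *)
Definition sph (g : Rn -> \bar R) (t : R) (x : Rn) : \bar R :=
  \int[sigma]_(w in usphere) g (vsub x (vscale t w)).

Lemma measurable_sphere_shift (t : R) :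
  measurable_fun setT (fun z : Rn * Rn => vsub z.1 (vscale t z.2)).
Proof.
apply/measurable_fun_tnthP => i; rewrite /comp.
under eq_fun do rewrite !tnth_mktuple.
apply: measurable_funB; last apply: measurable_funM => //.
  exact: (measurableT_comp (measurable_tnth i) measurable_fst).
exact: (measurableT_comp (measurable_tnth i) measurable_snd).
Qed.

Lemma measurable_shiftr (t : R) (x : Rn) :
  measurable_fun setT (fun w : Rn => vsub x (vscale t w)).
Proof.
apply/measurable_fun_tnthP => i; rewrite /comp.
under eq_fun do rewrite !tnth_mktuple.
apply: measurable_funB => //; apply: measurable_funM => //.
exact: measurable_tnth.
Qed.

Hypothesis n0 : (0 < n)%N.

Lemma ge0_integral_usphere (g : Rn -> \bar R) : measurable_fun setT g ->
  (forall x, 0 <= g x) -> \int[sigma]_(w in usphere) g w = \int[sigma]_w g w.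
Proof.
move=> mg g0; rewrite [RHS](ge0_negligible_integral (N := ~` usphere))//.
- by rewrite setDE setCK setTI.
- by apply: measurableC; exact: measurable_usphere.
- exact: sphere_measureC.
Qed.

Lemma sphE (g : Rn -> \bar R) t x : measurable_fun setT g ->
  (forall x, 0 <= g x) -> sph g t x = \int[sigma]_w g (vsub x (vscale t w)).
Proof.
move=> mg g0; apply: (ge0_integral_usphere (fun w => g (vsub x (vscale t w)))) => //.
exact: (measurableT_comp mg (measurable_shiftr t x)).
Qed.

Lemma sph_ge0 (g : Rn -> \bar R) t x : (forall x, 0 <= g x) -> 0 <= sph g t x.
Proof. by move=> g0; apply: integral_ge0. Qed.

Lemma measurable_sph (g : Rn -> \bar R) t : measurable_fun setT g ->
  (forall x, 0 <= g x) -> measurable_fun setT (sph g t).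
Proof.
move=> mg g0; rewrite (_ : sph g t = fubini_F sigma (fun z => g (vsub z.1 (vscale t z.2)))).
  apply: measurable_fun_fubini_tonelli_F => //=.
  exact: (measurableT_comp mg (measurable_sphere_shift t)).
by apply/funext => x; exact: sphE.
Qed.

(** By Tonelli and translation invariance, averaging preserves the integral. *)
Lemma integral_sph (g : Rn -> \bar R) t : measurable_fun setT g ->
  (forall x, 0 <= g x) -> \int[mu]_x sph g t x = \int[mu]_x g x.
Proof.
move=> mg g0.
under eq_integral do rewrite sphE//.
rewrite (fubini_tonelli (m1 := mu) (m2 := sigma) (fun z => g (vsub z.1 (vscale t z.2))))//=; last first.
  exact: (measurableT_comp mg (measurable_sphere_shift t)).
under eq_integral => w _ do rewrite (ge0_integral_translate (vscale t w) g mg g0).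
by rewrite integral_cst// [X in _ * X]sphere_measureT mule1.
Qed.

Lemma sph0 (g : Rn -> \bar R) x : (forall x, 0 <= g x) -> sph g 0 x = g x.
Proof.
move=> g0; rewrite /sph (eq_integral (cst (g x))); last first.
  by move=> w _; rewrite vscale0 vsubv0.
rewrite integral_cst; last exact: measurable_usphere.
by rewrite [X in _ * X]sphere_measure_usphere// mule1.
Qed.

(** Cauchy-Schwarz on the cap of directions that reach the support of u. *)
Lemma sph_sqr_le (u : Rn -> R) (x0 : Rn) (r t : R) (x : Rn) :
  measurable_fun setT u -> (forall y, ~ eball x0 r y -> u y = 0%R) ->
  (0 < r)%R -> (0 <= t)%R ->
  (sph (fun y => `|u y|%:E) t x) `^ 2 <=
    (4 * (6 ^+ n * (r / (r + t)) ^+ n.-1))%:E * sph (fun y => (u y ^+ 2)%:E) t x.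
Proof.
move=> mu_ su r0 t0.
have rt0 : (0 < r + t)%R by rewrite ltr_wpDr.
rewrite (_ : sph (fun y => (u y ^+ 2)%:E) t x =
    \int[sigma]_(w in usphere) (`|u (vsub x (vscale t w))| ^+ 2)%:E); last first.
  by apply: eq_integral => w _; rewrite real_normK ?num_real.
apply: (integral_sqr_le sigma usphere [set w | eball x0 r (vsub x (vscale t w))]).
- exact: measurable_usphere.
- rewrite -[X in measurable X]setTI; apply: (measurable_shiftr t x) => //.
  exact: measurable_eball.
- apply: measurableT_comp => //.
  exact: (measurableT_comp mu_ (measurable_shiftr t x)).
- by move=> w; exact: normr_ge0.
- by move=> w _ /su ->; rewrite normr0.
- by rewrite mulr_gt0 ?exprn_gt0// divr_gt0.
- exact: sphere_cap_le.
Qed.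

(** Triangle inequality: x is at distance t from every point entering the mean. *)
Lemma sph_support (u : Rn -> R) (x0 : Rn) (r t : R) (x : Rn) :
  (forall y, ~ eball x0 r y -> u y = 0%R) -> (0 <= t)%R ->
  ~ eball x0 (r + t) x -> sph (fun y => `|u y|%:E) t x = 0.
Proof.
move=> su t0 xB; rewrite /sph (eq_integral (cst 0)) ?integral_cst ?mul0e//; last first.
  move=> w; rewrite inE /usphere/= => w1; rewrite su ?normr0//= => h.
  apply: xB; apply: (le_trans (enorm_triangle (vsub x (vscale t w)) _ _)).
  rewrite addrC lerD//.
  have -> : vsub x (vsub x (vscale t w)) = vscale t w.
    by apply: eq_from_tnth => i; rewrite !tnth_mktuple subKr.
  by rewrite enorm_vscale w1 mulr1 ger0_norm.
exact: measurable_usphere.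
Qed.

End sph.

(** * Uniform weighted bound for spherical means of blocks *)

Section young.
Context {R : realType}.

(** A weak form of Young's inequality: (k a)^q b^(1-q) is at most the maximum of
    k a and b.  After integration, optimising over k recovers Hoelder's inequality. *)
Lemma powR_interp_le (q a b k : R) : 0 < q -> q < 1 -> 0 <= a -> 0 <= b -> 0 < k ->
  a `^ q * b `^ (1 - q) <= k `^ (1 - q) * a + k `^ (- q) * b.
Proof.
move=> q0 q1 a0 b0 k0.
have kq : k `^ (1 - q) = k * k `^ (- q).
  by rewrite powRD ?powRr1 ?(ltW k0)// (gt_eqF k0) implybT.
have aE : k `^ (- q) * (k * a) `^ q = a `^ q.
  by rewrite powRM ?(ltW k0)// mulrA -powRD ?(gt_eqF k0) ?implybT// addNr powRr0 mul1r.
have ka0 : 0 <= k * a by rewrite mulr_ge0// ltW.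
have -> : k `^ (1 - q) * a + k `^ (- q) * b = k `^ (- q) * (k * a + b) by rewrite kq; ring.
rewrite -aE -mulrA.
apply: ler_wpM2l; first exact: powR_ge0.
set M := Num.max (k * a) b.
have M0 : 0 <= M by rewrite le_max ka0.
apply: (@le_trans _ _ M).
  apply: (@le_trans _ _ (M `^ q * M `^ (1 - q))).
    apply: ler_pM; rewrite ?powR_ge0//.
    - by apply: ge0_ler_powR; rewrite ?nnegrE ?(ltW q0)// le_max lexx.
    - by apply: ge0_ler_powR; rewrite ?nnegrE ?subr_ge0 ?(ltW q1)// le_max lexx orbT.
  have [->|Mn0] := eqVneq M 0; first by rewrite powR0 ?mul0r// gt_eqF.
  by rewrite -powRD ?Mn0 ?implybT// addrC subrK powRr1.
by rewrite ge_max lerDl b0 lerDr ka0.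
Qed.

Lemma powR_div (a b q : R) : 0 <= a -> 0 <= b -> (a / b) `^ q = a `^ q / b `^ q.
Proof.
move=> a0 b0; rewrite powRM ?invr_ge0//; congr (_ * _).
by rewrite -[b^-1]powR_inv1// powRAC powR_inv1// powR_ge0.
Qed.

Lemma sqr_powR_half (x p : R) : 0 <= x -> (x ^+ 2) `^ (p / 2) = x `^ p.
Proof.
by move=> x0; rewrite -[x ^+ 2]powR_mulrn// -powRrM [2 * _]mulrC divfK.
Qed.

Lemma poweR_interp_le (p b k : R) (y a : \bar R) : 0 < p -> p < 2 -> 0 <= b -> 0 < k ->
  (0 <= y)%E -> (0 <= a)%E -> (y `^ 2 <= a)%E ->
  (y `^ p * (b `^ (1 - p / 2))%:E <= (k `^ (1 - p / 2))%:E * a + (k `^ (- (p / 2)) * b)%:E)%E.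
Proof.
move=> p0 p2 b0 k0 y0 a0 ya.
have q0 : 0 < p / 2 by rewrite divr_gt0.
have q1 : p / 2 < 1 by rewrite ltr_pdivrMr// mul1r.
case: a a0 ya => [a| |]// a0 ya; last first.
  by rewrite gt0_muley ?lte_fin ?powR_gt0// addye// leey.
case: y y0 ya => [y| |]//; last first.
  by rewrite poweRyr ?pnatr_eq0// leye_eq.
rewrite lee_fin => y0 ya; rewrite lee_fin in a0.
rewrite poweR_EFin lee_fin in ya; rewrite poweR_EFin -!EFinM -EFinD lee_fin.
apply: le_trans (powR_interp_le _ _ _ _ q0 q1 _ b0 k0) => //.
apply: ler_wpM2r; first exact: powR_ge0.
have -> : y `^ p = (y `^ 2) `^ (p / 2) by rewrite -powRrM mulrC divfK.
by apply: ge0_ler_powR; rewrite ?nnegrE ?powR_ge0 ?(ltW q0).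
Qed.
End young.

Section uniform_bound.
Context {R : realType} {n : nat}.
Local Notation Rn := (n.-tuple R).
Local Notation mu := (lebesgue_Rn R n).
Local Open Scope ereal_scope.
Variables p alpha : R.
Hypothesis n0 : (0 < n)%N.
Hypothesis p0 : (0 < p)%R.
Hypothesis p2 : (p < 2)%R.
Hypothesis alo : (n%:R * (2^-1 * p - 1) < alpha)%R.
Hypothesis aup : (alpha < n%:R * ((n%:R - 1) / n%:R * p - 1))%R.
Hypothesis a0 : (alpha <= 0)%R.

Let q : R := (p / 2)%R.
Let beta : R := (alpha / (1 - q))%R.
Let s : R := (alpha + n%:R - n%:R * q)%R.

(** Pointwise, sph_sqr_le and powR_interp_le bound the integrand by a multiple of
    the mean of u^2 plus a multiple of |x|^beta on the ball of radius rho = r + t.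
    The value of k balances the two integrals, and both become
    th^q M^p rho^s with th = (r/rho)^(n-1).  As s <= (n-1)q, this is at most
    M^p r^s. *)
Lemma sph_bound : exists2 C : R, (0 < C)%R &
  forall (u : Rn -> R) (x0 : Rn) (r t M : R),
    measurable_fun setT u -> (forall x, ~ eball x0 r x -> u x = 0%R) ->
    (0 < r)%R -> (0 <= t)%R -> (0 < M)%R ->
    \int[mu]_x (u x ^+ 2)%:E <= (M ^+ 2)%:E ->
    \int[mu]_x ((sph (fun y => `|u y|%:E) t x) `^ p * (enorm x `^ alpha)%:E)
      <= (C * (M `^ p * r `^ s))%:E.
Proof.
have nR0 : (0 < n%:R :> R)%R by rewrite ltr0n.
have q0 : (0 < q)%R by rewrite divr_gt0.
have q1 : (q < 1)%R by rewrite ltr_pdivrMr// mul1r.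
have q1' : (0 < 1 - q)%R by rewrite subr_gt0.
have bq : (beta * (1 - q) = alpha)%R by rewrite divfK// gt_eqF.
have alo' : (- (n%:R * (1 - q)) < alpha)%R by move: alo; rewrite /q; lra.
have b_lo : (- n%:R < beta)%R by rewrite ltr_pdivlMr// mulNr.
have b0 : (beta <= 0)%R by rewrite ler_pdivrMr// mul0r.
have s0 : (0 < s)%R by rewrite /s; lra.
have aup' : (alpha < (n%:R - 1) * p - n%:R)%R.
  have -> : ((n%:R - 1) * p - n%:R = n%:R * ((n%:R - 1) / n%:R * p - 1) :> R)%R.
    by field; exact: lt0r_neq0.
  exact: aup.
(* this is where the upper bound on alpha enters *)
have sn : (s <= n.-1%:R * q)%R.
  have -> : (n.-1%:R = n%:R - 1 :> R)%R by rewrite -subn1 natrB.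
  by move: aup' p0; rewrite /s /q; lra.
have [C3 C30 HC3] := integral_weight_ball beta b_lo b0 (n := n).
set K : R := (4 * 6 ^+ n)%R.
have K0 : (0 < K)%R by rewrite mulr_gt0// exprn_gt0.
exists (K + C3)%R; first by rewrite addr_gt0.
move=> u x0 r t M mu_ su r0 t0 M0 uM.
set rho := (r + t)%R.
have rho0 : (0 < rho)%R by rewrite ltr_wpDr.
set th := ((r / rho) ^+ n.-1)%R.
have rr0 : (0 < r / rho)%R by rewrite divr_gt0.
have rr1 : (r / rho <= 1)%R by rewrite ler_pdivrMr// mul1r lerDl.
have th0 : (0 < th)%R by rewrite exprn_gt0.
set P := (rho `^ (n%:R + beta))%R; have P0 : (0 < P)%R by rewrite powR_gt0.
(* k th M^2 = P equates the two terms of the interpolation *)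
set k := (P / (th * M ^+ 2))%R.
have k0 : (0 < k)%R by rewrite divr_gt0// mulr_gt0// exprn_gt0.
pose h x := sph (fun y => (u y ^+ 2)%:E) t x.
have mu2 : measurable_fun setT (fun y => (u y ^+ 2)%:E).
  by apply/measurable_EFinP; exact: measurable_funX.
have mau : measurable_fun setT (fun y => `|u y|%:E).
  by apply/measurable_EFinP; exact: measurableT_comp.
have u20 y : 0 <= (u y ^+ 2)%:E by rewrite lee_fin sqr_ge0.
have h0 x : 0 <= h x by exact: sph_ge0.
have mh : measurable_fun setT h by exact: measurable_sph.
have Ih : \int[mu]_x h x <= (M ^+ 2)%:E by rewrite integral_sph.
pose b (x : Rn) : R := (enorm x `^ beta * \1_(eball x0 rho) x)%R.
have bn x : (0 <= b x)%R by rewrite mulr_ge0// powR_ge0.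
have mb : measurable_fun setT (fun x => (b x)%:E).
  apply/measurable_EFinP; apply: measurable_funM.
    by apply/measurable_EFinP; exact: measurable_weight.
  by apply: measurable_indic; exact: measurable_eball.
have Ib : \int[mu]_x (b x)%:E <= (C3 * P)%:E.
  apply: le_trans (HC3 x0 rho rho0).
  rewrite [leRHS]integral_mkcond le_eqVlt; apply/orP; left; apply/eqP.
  apply: eq_integral => x _; rewrite /b patchE indicE; case: (x \in _).
    by rewrite mulr1.
  by rewrite mulr0.
have kP : (k `^ (- q) * P = th `^ q * M `^ p * rho `^ s)%R.
  have E1 : (P = P `^ q * P `^ (1 - q))%R.
    by rewrite -powRD ?(gt_eqF P0) ?implybT// addrC subrK powRr1 ?(ltW P0).
  set X := (th * M ^+ 2)%R in k k0 *.
  have X0 : (0 < X)%R by rewrite mulr_gt0// exprn_gt0.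
  have kE : (k `^ q = P `^ q / X `^ q)%R.
    exact: (powR_div _ _ q (ltW P0) (ltW X0)).
  have XE : (X `^ q = th `^ q * M `^ p)%R.
    rewrite /X (powRM q (ltW th0) (sqr_ge0 M)); congr (_ * _)%R.
    exact: (sqr_powR_half M p (ltW M0)).
  have PE : (P `^ (1 - q) = rho `^ s)%R.
    by rewrite /P -powRrM mulrDl bq /s; congr (_ `^ _)%R; ring.
  rewrite powRN {1}E1 kE -XE -PE.
  have Xq : (X `^ q != 0)%R by rewrite gt_eqF// powR_gt0.
  have Pq : (P `^ q != 0)%R by rewrite gt_eqF// powR_gt0.
  by field; rewrite Xq Pq.
have sc : (th `^ q * rho `^ s <= r `^ s)%R.
  have -> : (r `^ s = (r / rho) `^ s * rho `^ s)%R.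
    by rewrite -powRM ?divfK ?gt_eqF// ltW.
  apply: ler_wpM2r; first exact: powR_ge0.
  rewrite /th -powR_mulrn ?(ltW rr0)// -powRrM.
  by apply: ger_powR => //; rewrite rr0.
have pt x : (sph (fun y => `|u y|%:E) t x) `^ p * (enorm x `^ alpha)%:E <=
    (k `^ (1 - q))%:E * ((K * th)%:E * h x) + (k `^ (- q) * b x)%:E.
  have y0 : 0 <= sph (fun y => `|u y|%:E) t x by apply: sph_ge0 => y; rewrite lee_fin.
  have rhs0 : 0 <= (K * th)%:E * h x by rewrite mule_ge0// lee_fin mulr_ge0// ltW.
  have [xB|xB] := pselect (eball x0 rho x); last first.
    rewrite (sph_support _ _ _ _ _ su t0 xB)// poweR0r ?gt_eqF// mul0e.
    apply: adde_ge0; last by rewrite lee_fin mulr_ge0// powR_ge0.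
    by apply: mule_ge0 => //; rewrite lee_fin powR_ge0.
  have -> : (enorm x `^ alpha = b x `^ (1 - q))%R.
    by rewrite /b indicE mem_set// mulr1 -powRrM bq.
  apply: poweR_interp_le => //.
  by have := sph_sqr_le n0 u x0 r t x mu_ su r0 t0; rewrite mulrA.
have mK : measurable_fun setT (fun x => (K * th)%:E * h x) by exact: measurable_funeM.
have mS : measurable_fun setT (fun x => (sph (fun y => `|u y|%:E) t x) `^ p * (enorm x `^ alpha)%:E).
  apply: emeasurable_funM; last exact: measurable_weight.
  by apply: measurableT_comp (measurable_poweR p) _; exact: measurable_sph.
apply: (@le_trans _ _ (\int[mu]_x ((k `^ (1 - q))%:E * ((K * th)%:E * h x) + (k `^ (- q))%:E * (b x)%:E))).
  apply: ge0_le_integral => //.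
  - by move=> x _; rewrite mule_ge0 ?poweR_ge0// lee_fin powR_ge0.
  - by apply: emeasurable_funD; exact: measurable_funeM.
have bE0 x : 0 <= (b x)%:E by rewrite lee_fin.
have p1 x : 0 <= (K * th)%:E * h x by rewrite mule_ge0// lee_fin mulr_ge0// ltW.
have f1 x : 0 <= (k `^ (1 - q))%:E * ((K * th)%:E * h x).
  by apply: mule_ge0 => //; rewrite lee_fin powR_ge0.
have f2 x : 0 <= (k `^ (- q))%:E * (b x)%:E.
  by apply: mule_ge0; rewrite lee_fin ?powR_ge0 ?bn.
have mf1 : measurable_fun setT (fun x => (k `^ (1 - q))%:E * ((K * th)%:E * h x)).
  exact: measurable_funeM.
have mf2 : measurable_fun setT (fun x => (k `^ (- q))%:E * (b x)%:E).
  exact: measurable_funeM.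
rewrite ge0_integralD//.
rewrite ge0_integralZl//; last by rewrite lee_fin powR_ge0.
rewrite ge0_integralZl//; last by rewrite lee_fin mulr_ge0// ltW.
rewrite ge0_integralZl//; last by rewrite lee_fin powR_ge0.
apply: (@le_trans _ _ ((k `^ (1 - q))%:E * ((K * th)%:E * (M ^+ 2)%:E) + (k `^ (- q))%:E * (C3 * P)%:E)).
  apply: leeD; apply: lee_wpmul2l => //; rewrite ?lee_fin ?powR_ge0//.
  by apply: lee_wpmul2l => //; rewrite lee_fin mulr_ge0// ltW.
rewrite -!EFinM -EFinD lee_fin.
have kq : (k `^ (1 - q) = k * k `^ (- q))%R.
  by rewrite powRD ?powRr1 ?(ltW k0)// (gt_eqF k0) implybT.
have kt : (k * (K * th * M ^+ 2) = K * P)%R.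
  by rewrite /k; field; rewrite !gt_eqF.
have -> : (k `^ (1 - q) * (K * th * M ^+ 2) + k `^ (- q) * (C3 * P) =
   (K + C3) * (k `^ (- q) * P))%R by rewrite kq mulrAC kt; ring.
rewrite kP; apply: ler_wpM2l; first by rewrite addr_ge0// ltW.
rewrite mulrAC mulrC; apply: ler_wpM2l => //; exact: powR_ge0.
Qed.

End uniform_bound.

(** * Spherical means and weighted deviations of real functions *)

Section average.
Context {R : realType} {n : nat}.
Local Notation Rn := (n.-tuple R).
Local Notation mu := (lebesgue_Rn R n).
Local Notation sigma := (@sphere_measure R n).

Definition avg (u : Rn -> R) (t : R) (x : Rn) : R :=
  \int[sigma]_(w in usphere) u (vsub x (vscale t w)).

Local Open Scope ereal_scope.

Definition sphabs (u : Rn -> R) (t : R) : Rn -> \bar R := sph (fun y => `|u y|%:E) t.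

Lemma sphabs_ge0 u t x : 0 <= sphabs u t x.
Proof. by apply: sph_ge0 => y; rewrite lee_fin. Qed.

Lemma measurable_shiftE (u : Rn -> R) t x : measurable_fun setT u ->
  measurable_fun usphere (fun w => (u (vsub x (vscale t w)))%:E).
Proof.
move=> mu_; apply: measurable_funTS; apply/measurable_EFinP.
exact: (measurableT_comp mu_ (measurable_shiftr t x)).
Qed.

Lemma integrable_shift (u : Rn -> R) t x : measurable_fun setT u ->
  sphabs u t x < +oo ->
  sigma.-integrable usphere (EFin \o (fun w => u (vsub x (vscale t w)))).
Proof. by move=> mu_ h; apply/integrableP; split => //; exact: measurable_shiftE. Qed.

(** When the right-hand side is infinite the mean is a conventional value, and
    there is nothing to prove. *)
Lemma avg_le (u : Rn -> R) t x : measurable_fun setT u ->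
  `|avg u t x|%:E <= sphabs u t x.
Proof.
move=> mu_; have [foo|] := ltP (sphabs u t x) +oo; last first.
  by rewrite leye_eq => /eqP ->; rewrite leey.
rewrite EFin_normr_Rintegral; last exact: integrable_shift.
  by apply: le_abse_integral; [exact: measurable_usphere|exact: measurable_shiftE].
exact: measurable_usphere.
Qed.

Lemma avgD (u v : Rn -> R) t x : measurable_fun setT u -> measurable_fun setT v ->
  sphabs u t x < +oo -> sphabs v t x < +oo ->
  avg (fun y => u y + v y)%R t x = (avg u t x + avg v t x)%R.
Proof.
move=> mu_ mv fu fv; apply: RintegralD; first exact: measurable_usphere.
  exact: integrable_shift.
exact: integrable_shift.
Qed.

Lemma avgZ (c : R) (u : Rn -> R) t x : measurable_fun setT u -> sphabs u t x < +oo ->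
  avg (fun y => c * u y)%R t x = (c * avg u t x)%R.
Proof.
move=> mu_ fu; apply: RintegralZl; first exact: measurable_usphere.
exact: integrable_shift.
Qed.

Hypothesis n0 : (0 < n)%N.

Lemma measurable_sphabs (u : Rn -> R) t : measurable_fun setT u ->
  measurable_fun setT (sphabs u t).
Proof.
move=> mu_; apply: measurable_sph => //.
by apply/measurable_EFinP; exact: measurableT_comp.
Qed.

Lemma measurable_avg (u : Rn -> R) t : measurable_fun setT u ->
  measurable_fun setT (avg u t).
Proof.
move=> mu_.
have muE : measurable_fun setT (EFin \o u) by apply/measurable_EFinP.
have mp : measurable_fun setT (sph (EFin \o u)^\+ t).
  by apply: measurable_sph => //; exact: measurable_funepos.
have mn : measurable_fun setT (sph (EFin \o u)^\- t).
  by apply: measurable_sph => //; exact: measurable_funeneg.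
rewrite (_ : avg u t = fun x => fine (sph (EFin \o u)^\+ t x - sph (EFin \o u)^\- t x)).
  apply: (@measurableT_comp _ _ _ _ _ _ fine) => //; exact: emeasurable_funB.
apply/funext => x; rewrite /avg /Rintegral integralE /sph; congr (fine (_ - _));
  by apply: eq_integral => w _; rewrite ?funeposE ?funenegE.
Qed.

(** The means of |u| have the same integral as |u|. *)
Lemma sphabs_ae_lty (u : Rn -> R) t : measurable_fun setT u ->
  \int[mu]_x `|u x|%:E < +oo -> {ae mu, forall x, sphabs u t x < +oo}.
Proof.
move=> mu_ ui.
have mau : measurable_fun setT (fun y => `|u y|%:E).
  by apply/measurable_EFinP; exact: measurableT_comp.
have : mu.-integrable setT (sphabs u t).
  apply/integrableP; split; first exact: measurable_sphabs.
  under eq_integral do rewrite gee0_abs ?sphabs_ge0//.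
  by rewrite integral_sph// => x; rewrite lee_fin.
move=> /(integrable_ae measurableT); apply: filterS => x /(_ I).
by rewrite ge0_fin_numE ?sphabs_ge0.
Qed.

End average.

Section deviation.
Context {R : realType} {n : nat}.
Local Notation Rn := (n.-tuple R).
Local Notation mu := (lebesgue_Rn R n).
Variables p alpha : R.
Hypothesis n0 : (0 < n)%N.
Hypothesis p0 : (0 < p)%R.
Hypothesis p2 : (p < 2)%R.
Hypothesis alo : (n%:R * (2^-1 * p - 1) < alpha)%R.
Hypothesis aup : (alpha < n%:R * ((n%:R - 1) / n%:R * p - 1))%R.
Hypothesis a0 : (alpha <= 0)%R.

Lemma powR_normD_le (a b : R) :
  `|a + b| `^ p <= 2 `^ p * (`|a| `^ p + `|b| `^ p).
Proof.
set m := Num.max `|a| `|b|.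
have m0 : 0 <= m by rewrite le_max normr_ge0.
apply: (@le_trans _ _ ((2 * m) `^ p)).
  apply: ge0_ler_powR; rewrite ?nnegrE ?(ltW p0) ?mulr_ge0//.
  rewrite (le_trans (ler_normD _ _))// mulr_natl mulr2n lerD// le_max lexx//.
  by rewrite orbT.
rewrite powRM//; apply: ler_wpM2l; first exact: powR_ge0.
by rewrite /m maxEle; case: ifP => _; [rewrite lerDr|rewrite lerDl]; exact: powR_ge0.
Qed.

Local Open Scope ereal_scope.

(** The p-th power of the weighted norm: it is subadditive up to a constant for
    every p > 0. *)
Definition wpnorm (g : Rn -> R) : \bar R :=
  \int[mu]_x (`|g x| `^ p * enorm x `^ alpha)%:E.

Lemma measurable_wpnorm (g : Rn -> R) : measurable_fun setT g ->
  measurable_fun setT (fun x => (`|g x| `^ p * enorm x `^ alpha)%:E).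
Proof.
move=> mg; apply/measurable_EFinP; apply: measurable_funM.
  apply: (measurableT_comp (measurable_powR p)).
  exact: measurableT_comp.
by apply/measurable_EFinP; exact: measurable_weight.
Qed.

Lemma wpnorm_ge0 (g : Rn -> R) : 0 <= wpnorm g.
Proof. by apply: integral_ge0 => x _; rewrite lee_fin mulr_ge0// powR_ge0. Qed.

Lemma wpnorm_leD (f g h : Rn -> R) : measurable_fun setT f -> measurable_fun setT g ->
  measurable_fun setT h -> {ae mu, forall x, f x = g x + h x}%R ->
  wpnorm f <= (2 `^ p)%:E * (wpnorm g + wpnorm h).
Proof.
move=> mf mg mh fgh.
rewrite -ge0_integralD//; first last.
- exact: measurable_wpnorm.
- by move=> x _; rewrite lee_fin mulr_ge0// powR_ge0.
- exact: measurable_wpnorm.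
- by move=> x _; rewrite lee_fin mulr_ge0// powR_ge0.
rewrite -ge0_integralZl//; first last.
- by move=> x _; rewrite adde_ge0// lee_fin mulr_ge0// powR_ge0.
- by apply: emeasurable_funD; exact: measurable_wpnorm.
apply: ae_ge0_le_integral => //.
- by move=> x _; rewrite lee_fin mulr_ge0// powR_ge0.
- exact: measurable_wpnorm.
- by move=> x _; rewrite -EFinD -EFinM lee_fin mulr_ge0 ?powR_ge0// addr_ge0// mulr_ge0// powR_ge0.
- by apply: measurable_funeM; apply: emeasurable_funD; exact: measurable_wpnorm.
apply: filterS fgh => x -> _.
rewrite -EFinD -EFinM lee_fin -mulrDl mulrA; apply: ler_wpM2r; first exact: powR_ge0.
exact: powR_normD_le.
Qed.

Lemma wpnormZ (c : R) (g : Rn -> R) : measurable_fun setT g ->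
  wpnorm (fun x => c * g x)%R = (`|c| `^ p)%:E * wpnorm g.
Proof.
move=> mg; rewrite -ge0_integralZl//; first last.
- by move=> x _; rewrite lee_fin mulr_ge0// powR_ge0.
- exact: measurable_wpnorm.
by apply: eq_integral => x _; rewrite normrM powRM// -EFinM mulrA.
Qed.

Definition dev (u : Rn -> R) (t : R) : \bar R := wpnorm (fun x => avg u t x - u x)%R.

Lemma measurable_dev (u : Rn -> R) t : measurable_fun setT u ->
  measurable_fun setT (fun x => avg u t x - u x)%R.
Proof. by move=> mu_; apply: measurable_funB => //; exact: measurable_avg. Qed.

(** The bound sph_bound at radius t controls the mean, and at radius 0 the
    function itself. *)
Lemma dev_bound : exists2 C : R, (0 < C)%R &
  forall (u : Rn -> R) (x0 : Rn) (r t M : R),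
    measurable_fun setT u -> (forall x, ~ eball x0 r x -> u x = 0%R) ->
    (0 < r)%R -> (0 <= t)%R -> (0 < M)%R ->
    \int[mu]_x (u x ^+ 2)%:E <= (M ^+ 2)%:E ->
    dev u t <= (C * (M `^ p * r `^ (alpha + n%:R - n%:R * (p / 2))))%:E.
Proof.
have [C C0 HC] := sph_bound p alpha n0 p0 p2 alo aup a0.
exists (2 `^ p * (C + C))%R; first by rewrite mulr_gt0 ?powR_gt0// addr_gt0.
move=> u x0 r t M mu_ su r0 t0 M0 uM.
have mavg := measurable_avg n0 u t mu_.
apply: (le_trans (wpnorm_leD _ (avg u t) (fun x => - u x)%R _ _ _ _)) => //.
- exact: measurable_dev.
- exact: measurableT_comp.
- exact: aeW.
rewrite -mulrA EFinM; apply: lee_wpmul2l; first by rewrite lee_fin powR_ge0.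
rewrite mulrDl EFinD; apply: leeD.
  apply: le_trans (HC u x0 r t M mu_ su r0 t0 M0 uM).
  apply: ge0_le_integral => //.
  - by move=> x _; rewrite lee_fin mulr_ge0// powR_ge0.
  - exact: measurable_wpnorm.
  - apply: emeasurable_funM; last exact: measurable_weight.
    by apply: measurableT_comp (measurable_poweR p) _; exact: measurable_sphabs.
  move=> x _; rewrite EFinM; apply: lee_wpmul2r; first by rewrite lee_fin powR_ge0.
  rewrite -poweR_EFin; apply: (gt0_ler_poweR (ltW p0)); rewrite ?in_itv/= ?leey ?lee_fin ?normr_ge0 ?sphabs_ge0//.
  exact: avg_le.
apply: le_trans (HC u x0 r 0%R M mu_ su r0 (lexx 0%R) M0 uM).
rewrite le_eqVlt; apply/orP; left; apply/eqP; apply: eq_integral => x _.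
rewrite (sph0 n0 (fun y => `|u y|%:E) x)//.
by rewrite normrN EFinM poweR_EFin.
Qed.

End deviation.

(** * Convergence to 0 as t decreases to 0 *)

Section tends0.
Context {R : realType}.
Local Open Scope ereal_scope.

(** For nonnegative F this is convergence to 0 from the right; as it bounds F from
    above only, it passes to smaller functions and avoids the side conditions of
    extended real arithmetic. *)
Definition tends0 (F : R -> \bar R) :=
  forall e : R, (0 < e)%R -> exists2 d : R, (0 < d)%R &
    forall t, (0 < t)%R -> (t < d)%R -> F t <= e%:E.

Lemma tends0_le (F G : R -> \bar R) : (forall t, (0 < t)%R -> F t <= G t) ->
  tends0 G -> tends0 F.
Proof.
move=> FG G0 e /G0[d d0 H]; exists d => // t t0 td.
exact: le_trans (FG t t0) (H t t0 td).
Qed.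

Lemma tends0D (F G : R -> \bar R) : tends0 F -> tends0 G -> tends0 (fun t => F t + G t).
Proof.
move=> F0 G0 e e0.
have e20 : (0 < e / 2)%R by rewrite divr_gt0.
have [d1 d10 H1] := F0 _ e20; have [d2 d20 H2] := G0 _ e20.
exists (Num.min d1 d2); first by rewrite lt_min d10.
move=> t t0; rewrite lt_min => /andP[t1 t2].
by rewrite [e]splitr EFinD leeD ?H1 ?H2.
Qed.

Lemma tends0Z (c : R) (F : R -> \bar R) : (0 <= c)%R -> tends0 F ->
  tends0 (fun t => c%:E * F t).
Proof.
move=> c0 F0 e e0.
have c1 : (0 < c + 1)%R by rewrite ltr_wpDl.
have [d d0 H] := F0 (e / (c + 1))%R (divr_gt0 e0 c1).
exists d => // t t0 td.
apply: (@le_trans _ _ (c%:E * (e / (c + 1))%:E)).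
  by apply: lee_wpmul2l; [rewrite lee_fin|exact: H].
rewrite -EFinM lee_fin mulrA ler_pdivrMr// mulrC ler_pM2l// lerDl//.
Qed.

(** Sequences are needed because dominated convergence is about sequences. *)
Lemma not_tends0_seq (F : R -> \bar R) : ~ tends0 F ->
  exists2 e : R, (0 < e)%R & exists t : nat -> R, forall k,
    [/\ (0 < t k)%R, (t k < k.+1%:R^-1)%R & e%:E <= F (t k)].
Proof.
move=> /existsNP[e /not_implyP[e0 H]]; exists e => //.
have P k : exists t, [/\ (0 < t)%R, (t < k.+1%:R^-1)%R & e%:E <= F t].
  apply: contrapT => N; apply: H; exists k.+1%:R^-1%R => // t t0 tk.
  by rewrite leNgt; apply/negP => /ltW eF; apply: N; exists t.
by exists (fun k => projT1 (cid (P k))) => k; case: (cid (P k)).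
Qed.

Lemma tends0_cvg (F : R -> \bar R) : (forall t, 0 <= F t) -> tends0 F ->
  F t @[t --> 0%R^'+] --> 0.
Proof.
move=> F0 T0; apply/cvge_at_rightP => u [u0 uc]; apply/fine_cvgP; split.
  have [d d0 H] := T0 1%R ltr01.
  have : \forall k \near \oo, (u k < d)%R by apply: (cvgr_lt 0%R uc).
  apply: filterS => k ud; rewrite ge0_fin_numE//.
  by apply: le_lt_trans (H _ (u0 k) ud) _; rewrite ltry.
apply/cvgrPdist_le => e e0 /=.
have [d d0 H] := T0 e e0.
have : \forall k \near \oo, (u k < d)%R by apply: (cvgr_lt 0%R uc).
apply: filterS => k ud; rewrite sub0r normrN.
have := H _ (u0 k) ud; have := F0 (u k); case: (F (u k)) => [z| |]//=.
  by rewrite !lee_fin => z0 ze; rewrite ger0_norm.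
Qed.

End tends0.

(** * Square integrable functions supported in a ball *)

Section admissible.
Context {R : realType} {n : nat}.
Local Notation Rn := (n.-tuple R).
Local Notation mu := (lebesgue_Rn R n).
Variables (x0 : Rn) (r : R).
Hypothesis r0 : (0 < r)%R.
Local Notation K := (eball x0 r).
Local Open Scope ereal_scope.

Definition L2_on (u : Rn -> R) := [/\ measurable_fun setT u,
  (forall x, ~ K x -> u x = 0%R) & \int[mu]_x (u x ^+ 2)%:E < +oo].

Lemma measurable_sqrE (u : Rn -> R) : measurable_fun setT u ->
  measurable_fun setT (fun x => (u x ^+ 2)%:E).
Proof. by move=> mu_; apply/measurable_EFinP; exact: measurable_funX. Qed.

(** On the ball, |u| <= 1 + u^2. *)
Lemma L2_on_L1 (u : Rn -> R) : L2_on u -> \int[mu]_x `|u x|%:E < +oo.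
Proof.
move=> [mu_ su iu].
have m1 : measurable_fun setT (fun x : Rn => (\1_K x)%:E : \bar R).
  by apply/measurable_EFinP; apply: measurable_indic; exact: measurable_eball.
have m2 := measurable_sqrE u mu_.
apply: (@le_lt_trans _ _ (\int[mu]_x ((\1_K x)%:E + (u x ^+ 2)%:E))).
  apply: ge0_le_integral => //.
  - by apply/measurable_EFinP; exact: measurableT_comp.
  - exact: emeasurable_funD.
  - move=> x _; rewrite -EFinD lee_fin indicE.
    have [xK|/negP xK] := boolP (x \in K).
      rewrite -[X in (_ + X)%R]real_normK ?num_real//.
      have : (0 <= (2 * `|u x| - 1) ^+ 2)%R by exact: sqr_ge0.
      rewrite /= mulr1n; nra.
    rewrite su ?normr0 ?expr0n ?add0r//= => xK'; apply: xK; rewrite inE//.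
rewrite ge0_integralD//; last by move=> x _; rewrite lee_fin sqr_ge0.
rewrite integral_indic ?setIT//; last exact: measurable_eball.
by rewrite lte_add_pinfty// [X in X < _](lebesgue_Rn_ball x0 r r0) ltry.
Qed.

Lemma sqr_integralD_lty (u v : Rn -> R) : measurable_fun setT u -> measurable_fun setT v ->
  \int[mu]_x (u x ^+ 2)%:E < +oo -> \int[mu]_x (v x ^+ 2)%:E < +oo ->
  \int[mu]_x ((u x + v x) ^+ 2)%:E < +oo.
Proof.
move=> mu_ mv iu iv.
have m1 := measurable_sqrE u mu_; have m2 := measurable_sqrE v mv.
have p1 (w : Rn -> R) x : 0 <= (w x ^+ 2)%:E by rewrite lee_fin sqr_ge0.
apply: (@le_lt_trans _ _ (\int[mu]_x (2%:E * ((u x ^+ 2)%:E + (v x ^+ 2)%:E)))).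
  apply: ge0_le_integral => //.
  - by move=> x _; rewrite lee_fin sqr_ge0.
  - by apply: measurable_sqrE; exact: measurable_funD.
  - by apply: measurable_funeM; exact: emeasurable_funD.
  - move=> x _; rewrite -EFinD -EFinM lee_fin.
    by have := sqr_ge0 (u x - v x); nra.
rewrite ge0_integralZl//; last 2 first.
- exact: emeasurable_funD.
- by move=> x _; rewrite adde_ge0.
rewrite ge0_integralD// lte_mul_pinfty// lte_add_pinfty//.
Qed.

Lemma L2_onD (u v : Rn -> R) : L2_on u -> L2_on v -> L2_on (fun x => u x + v x)%R.
Proof.
move=> [mu_ su iu] [mv sv iv]; split.
- exact: measurable_funD.
- by move=> x xK; rewrite su// sv// addr0.
- exact: sqr_integralD_lty.
Qed.

Lemma L2_onZ (c : R) (u : Rn -> R) : L2_on u -> L2_on (fun x => c * u x)%R.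
Proof.
move=> [mu_ su iu]; split.
- exact: measurable_funM.
- by move=> x xK; rewrite su// mulr0.
under eq_integral do rewrite exprMn EFinM.
rewrite ge0_integralZl//; last 3 first.
- exact: measurable_sqrE.
- by move=> x _; rewrite lee_fin sqr_ge0.
- by rewrite lee_fin sqr_ge0.
by rewrite lte_mul_pinfty// lee_fin sqr_ge0.
Qed.

Lemma L2_on_indic (E : set Rn) : measurable E -> L2_on (\1_(E `&` K)).
Proof.
move=> mE; have mEK : measurable (E `&` K) by apply: measurableI => //; exact: measurable_eball.
split.
- exact: measurable_indic.
- by move=> x xK; rewrite indicE memNset// => -[].
rewrite (eq_integral (fun x => (\1_(E `&` K) x)%:E)); last first.
  by move=> x _; rewrite indicE; case: (x \in _); rewrite ?expr1n ?expr0n.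
rewrite integral_indic ?setIT//.
apply: (@le_lt_trans _ _ (mu K)).
  by apply: le_measure; rewrite ?inE//; exact: measurable_eball.
by rewrite lebesgue_Rn_ball// ltry.
Qed.

End admissible.

(** * The class of functions whose deviation tends to 0 *)

Section mean_cvg_class.
Context {R : realType} {n : nat}.
Local Notation Rn := (n.-tuple R).
Local Notation mu := (lebesgue_Rn R n).
Variables p alpha : R.
Hypothesis n0 : (0 < n)%N.
Hypothesis p0 : (0 < p)%R.
Hypothesis p2 : (p < 2)%R.
Hypothesis alo : (n%:R * (2^-1 * p - 1) < alpha)%R.
Hypothesis aup : (alpha < n%:R * ((n%:R - 1) / n%:R * p - 1))%R.
Hypothesis a0 : (alpha <= 0)%R.
Variables (x0 : Rn) (r : R).
Hypothesis r0 : (0 < r)%R.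
Local Notation K := (eball x0 r).
Local Notation L2_on := (L2_on x0 r).
Local Notation dev := (dev p alpha).
Local Notation wpnorm := (wpnorm p alpha).
Local Open Scope ereal_scope.

Lemma wpnorm_ae_eq (f g : Rn -> R) : measurable_fun setT f -> measurable_fun setT g ->
  {ae mu, forall x, f x = g x} -> wpnorm f = wpnorm g.
Proof.
move=> mf mg fg; apply: ge0_ae_eq_integral => //.
- exact: measurable_wpnorm.
- exact: measurable_wpnorm.
- by move=> x _; rewrite lee_fin mulr_ge0// powR_ge0.
- by move=> x _; rewrite lee_fin mulr_ge0// powR_ge0.
- by apply: filterS fg => x -> _.
Qed.

Lemma dev_ge0 (u : Rn -> R) t : 0 <= dev u t.
Proof. exact: wpnorm_ge0. Qed.

Lemma dev_leD (u v : Rn -> R) t : L2_on u -> L2_on v ->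
  dev (fun x => u x + v x)%R t <= (2 `^ p)%:E * (dev u t + dev v t).
Proof.
move=> au av; have [mu_ _ _] := au; have [mv _ _] := av.
apply: wpnorm_leD => //; try exact: measurable_dev.
  by apply: measurable_dev => //; exact: measurable_funD.
have fu := sphabs_ae_lty n0 u t mu_ (L2_on_L1 _ _ r0 _ au).
have fv := sphabs_ae_lty n0 v t mv (L2_on_L1 _ _ r0 _ av).
apply: filterS2 fu fv => x fux fvx.
by rewrite avgD//; ring.
Qed.

Lemma devZ (c : R) (u : Rn -> R) t : L2_on u ->
  dev (fun x => c * u x)%R t = (`|c| `^ p)%:E * dev u t.
Proof.
move=> au; have [mu_ _ _] := au.
rewrite -(wpnormZ p alpha c _ (measurable_dev n0 u t mu_)).
apply: wpnorm_ae_eq.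
- by apply: measurable_dev => //; exact: measurable_funM.
- by apply: measurable_funM => //; exact: measurable_dev.
have fu := sphabs_ae_lty n0 u t mu_ (L2_on_L1 _ _ r0 _ au).
apply: filterS fu => x fux.
by rewrite avgZ//; ring.
Qed.

(** The class that turns out to contain every square integrable function supported
    in the ball. *)
Definition mean_cvg (u : Rn -> R) := L2_on u /\ tends0 (dev u).

Lemma mean_cvgD (u v : Rn -> R) : mean_cvg u -> mean_cvg v -> mean_cvg (fun x => u x + v x)%R.
Proof.
move=> [au gu] [av gv]; split; first exact: L2_onD.
apply: (tends0_le _ (fun t => (2 `^ p)%:E * (dev u t + dev v t))).
  by move=> t _; exact: dev_leD.
by apply: tends0Z; [exact: powR_ge0|exact: tends0D].
Qed.

Lemma mean_cvgZ (c : R) (u : Rn -> R) : mean_cvg u -> mean_cvg (fun x => c * u x)%R.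
Proof.
move=> [au gu]; split; first exact: L2_onZ.
rewrite (_ : dev _ = fun t => (`|c| `^ p)%:E * dev u t); last first.
  by apply/funext => t; exact: devZ.
by apply: tends0Z => //; exact: powR_ge0.
Qed.

(** The deviation of v - u is small uniformly in t by dev_bound, so the class is
    closed in L^2. *)
Lemma mean_cvg_approx (v : Rn -> R) : L2_on v ->
  (forall e : R, (0 < e)%R -> exists2 u, mean_cvg u &
     \int[mu]_x ((v x - u x) ^+ 2)%:E <= (e ^+ 2)%:E) -> mean_cvg v.
Proof.
move=> av H; split => //.
have [C C0 HC] := dev_bound p alpha n0 p0 p2 alo aup a0.
set s := (alpha + n%:R - _)%R in HC.
have rs : (0 < r `^ s)%R by exact: powR_gt0.
have tp : (0 < 2 `^ p :> R)%R by exact: powR_gt0.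
move=> e e0.
set D := (2 `^ p * (C * r `^ s) * 2)%R.
have D0 : (0 < D)%R by rewrite !mulr_gt0.
(* chosen so that the uniform bound for v - u contributes e / 2 in the end *)
set d := ((e / D) `^ p^-1)%R.
have d0 : (0 < d)%R by rewrite powR_gt0// divr_gt0.
have dp : (d `^ p = e / D)%R.
  by rewrite /d -powRrM mulVf ?gt_eqF// powRr1// divr_ge0// ltW.
have [u [au gu] uv] := H d d0.
have e1 : (0 < e / (2 * 2 `^ p))%R by rewrite divr_gt0// mulr_gt0.
have [dd dd0 Hd] := gu _ e1.
exists dd => // t t0 td.
have avu : L2_on (fun x => v x - u x)%R.
  rewrite (_ : (fun x => _) = fun x => v x + (-1) * u x)%R.
    by apply: L2_onD => //; exact: L2_onZ.
  by apply/funext => x; rewrite mulN1r.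
rewrite (_ : v = fun x => (v x - u x) + u x)%R; last first.
  by apply/funext => x; rewrite subrK.
apply: (le_trans (dev_leD _ _ t avu au)).
have [mvu svu _] := avu.
apply: (@le_trans _ _ ((2 `^ p)%:E * ((C * (d `^ p * r `^ s))%:E + (e / (2 * 2 `^ p))%:E))).
  apply: lee_wpmul2l; first by rewrite lee_fin ltW.
  by apply: leeD; [exact: (HC _ x0 r t d mvu svu r0 (ltW t0) d0 uv)|exact: Hd].
rewrite -EFinD -EFinM lee_fin dp /D le_eqVlt; apply/orP; left; apply/eqP.
by field; rewrite !gt_eqF.
Qed.

(** Continuity sets of Lebesgue measure: the indicator of E is locally constant at
    almost every point, that is, the boundary of E is null. *)
Definition continuity_set (E : set Rn) := measurable E /\
  {ae mu, forall x, exists2 e : R, (0 < e)%R &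
     forall y, (enorm (vsub x y) <= e)%R -> (E y <-> E x)}.

Lemma continuity_setI : setI_closed continuity_set.
Proof.
move=> E F [mE tE] [mF tF]; split; first exact: measurableI.
apply: filterS2 tE tF => x [e e0 He] [f f0 Hf].
exists (Num.min e f); first by rewrite lt_min e0.
move=> y; rewrite le_min => /andP[ye yf]; have := He y ye; have := Hf y yf.
by rewrite /setI/=; tauto.
Qed.

Lemma continuity_set_halfspace (i : 'I_n) (c : R) : continuity_set [set x | (tnth x i < c)%R].
Proof.
split.
  have -> : [set x | (tnth x i < c)%R] = [set x : Rn | `]-oo, c[%classic (tnth x i)].
    by apply/seteqP; split => x /=; rewrite in_itv.
  exact: (measurable_coord i `]-oo, c[%classic).
exists [set x | tnth x i = c]; split.
- exact: (measurable_coord i [set c]).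
- exact: lebesgue_Rn_hyperplane.
move=> x /=; apply: contra_notP => /eqP xc.
exists (`|tnth x i - c| / 2)%R; first by rewrite divr_gt0// normr_gt0 subr_eq0.
move=> y xy.
have := le_trans (ler_enorm_coord (vsub x y) i) xy; rewrite tnth_mktuple.
move: xc; rewrite neq_lt => /orP[xc|xc] h.
  move: h; rewrite [X in (_ <= X / _)%R]ltr0_norm ?subr_lt0// ler_norml => /andP[h1 h2].
  by split => _ //; lra.
move: h; rewrite [X in (_ <= X / _)%R]gtr0_norm ?subr_gt0// ler_norml => /andP[h1 h2].
by split => h; lra.
Qed.

(** The sphere of radius r lies between the balls of radii r(1-d) and r, whose
    volumes differ by O(d) by Bernoulli's inequality. *)
Lemma sphere_null : mu [set x | enorm (vsub x x0) = r] = 0.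
Proof.
set S := [set x | _].
have mS : measurable S.
  rewrite -[X in measurable X]setTI.
  have m := measurableT_comp (@measurable_enorm R n) (measurable_vsubl x0).
  exact: (m measurableT [set r] (measurable_set1 r)).
apply/eqP; rewrite eq_le measure_ge0 andbT.
apply/lee_addgt0Pr => e e0; rewrite add0e.
set w := vol1 (R := R) (n := n); have w0 : (0 < w)%R := vol1_gt0.
have nr : (0 < n%:R :> R)%R by rewrite ltr0n.
set D := (r ^+ n * w * n%:R)%R.
have D0 : (0 < D)%R by rewrite !mulr_gt0// exprn_gt0.
pose d : R := (Num.min (e / D) 2^-1)%R.
have d0 : (0 < d)%R by rewrite lt_min divr_gt0// invr_gt0 ltr0n.
have d1 : (d < 1)%R by rewrite /d gt_min [X in _ || X](_ : _ = true) ?orbT//; lra.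
have de : (d <= e / D)%R by rewrite /d ge_min lexx.
have rd0 : (0 < r * (1 - d))%R by rewrite mulr_gt0// subr_gt0.
have h : mu S + mu (eball x0 (r * (1 - d))%R) <= mu (eball x0 r).
  rewrite -measureU//; last first.
  - apply/eqP/negPn/negP => /set0P[x [xS]]; rewrite /eball/= xS.
    by rewrite ler_pMr//; lra.
  - exact: measurable_eball.
  apply: le_measure; rewrite ?inE//; try exact: measurable_eball.
    by apply: measurableU => //; exact: measurable_eball.
  move=> x; rewrite /S /eball/= => -[->//|h]; rewrite (le_trans h)//.
  by rewrite ler_piMr ?(ltW r0)//; lra.
rewrite !lebesgue_Rn_ball// in h.
have bern m : (1 - m%:R * d <= (1 - d) ^+ m)%R.
  elim: m => [|m IH]; first by rewrite mul0r subr0 expr0.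
  rewrite exprS -natr1.
  have h1 : ((1 - d) * (1 - m%:R * d) <= (1 - d) * (1 - d) ^+ m)%R.
    by rewrite ler_pM2l// subr_gt0.
  apply: le_trans h1; have : (0 <= m%:R * d * d :> R)%R by rewrite !mulr_ge0// ltW.
  by nra.
have {h} : mu S <= (r ^+ n * w - (r * (1 - d)) ^+ n * w)%:E.
  by rewrite EFinB leeBrDr.
move=> h; apply: (le_trans h); rewrite lee_fin exprMn.
apply: (@le_trans _ _ (d * D)%R); last by rewrite -ler_pdivlMr.
have := bern n; rewrite -(ler_pM2l (_ : 0 < r ^+ n * w)%R); last by rewrite mulr_gt0// exprn_gt0.
by rewrite /D; lra.
Qed.

Lemma continuity_set_eball : continuity_set K.
Proof.
split; first exact: measurable_eball.
exists [set x | enorm (vsub x x0) = r]; split.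
- have m := measurableT_comp (@measurable_enorm R n) (measurable_vsubl x0).
  by have := m measurableT [set r] (measurable_set1 r); rewrite setTI.
- exact: sphere_null.
move=> x /=; apply: contra_notP => /eqP xr.
exists (`|enorm (vsub x x0) - r| / 2)%R; first by rewrite divr_gt0// normr_gt0 subr_eq0.
move=> y xy; rewrite /eball/=.
have t1 := enorm_triangle y x x0.
have t2 := enorm_triangle x y x0; rewrite enormB in t2.
have t3 := enorm_ge0 (vsub x y); rewrite enormB in t2.
move: xr; rewrite neq_lt => /orP[xr|xr].
  move: xy; rewrite ltr0_norm ?subr_lt0// => xy.
  rewrite (enormB y x) in t2; split => h; lra.
move: xy; rewrite gtr0_norm ?subr_gt0// => xy.
rewrite (enormB y x) in t2; split => h; lra.
Qed.

End mean_cvg_class.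

(** * Convergence for square integrable functions on a ball *)

Section convergence.
Context {R : realType} {n : nat}.
Local Notation Rn := (n.-tuple R).
Local Notation mu := (lebesgue_Rn R n).
Local Notation sigma := (@sphere_measure R n).
Variables p alpha : R.
Hypothesis n0 : (0 < n)%N.
Hypothesis p0 : (0 < p)%R.
Hypothesis p2 : (p < 2)%R.
Hypothesis alo : (n%:R * (2^-1 * p - 1) < alpha)%R.
Hypothesis aup : (alpha < n%:R * ((n%:R - 1) / n%:R * p - 1))%R.
Hypothesis a0 : (alpha <= 0)%R.
Variables (x0 : Rn) (r : R).
Hypothesis r0 : (0 < r)%R.
Local Notation K := (eball x0 r).
Local Notation L2_on := (L2_on x0 r).
Local Notation dev := (dev p alpha).
Local Notation mean_cvg := (mean_cvg p alpha x0 r).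
Local Notation gD := (mean_cvgD p alpha n0 p0 x0 r r0 _ _).
Local Notation gZ := (mean_cvgZ p alpha n0 x0 r r0 _ _).
Local Open Scope ereal_scope.

Lemma sphabs_indic_le (E : set Rn) t x : measurable E -> sphabs \1_E t x <= 1.
Proof.
move=> mE; apply: (@le_trans _ _ (\int[sigma]_(w in @usphere R n) cst 1 w)).
  apply: ge0_le_integral => //; first exact: measurable_usphere.
  - apply: measurable_funTS; apply/measurable_EFinP; apply: measurableT_comp => //.
    exact: (measurableT_comp (measurable_indic mE) (measurable_shiftr t x)).
  - by move=> w _; rewrite lee_fin indicE; case: (_ \in _); rewrite ?normr1 ?normr0.
rewrite integral_cst; last exact: measurable_usphere.
by rewrite [X in _ * X]sphere_measure_usphere// mule1.
Qed.

(** At almost every x the mean of the indicator equals its value at x once t is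
    smaller than the distance from x to the boundary.  For t <= 1 everything is
    supported in a fixed ball, over which the weight is integrable. *)
Lemma dev_indic_tends0 (E : set Rn) : continuity_set E -> E `<=` K -> tends0 (dev \1_E).
Proof.
move=> [mE tE] EK; apply: contrapT => /not_tends0_seq[e e0 [t Ht]].
have mi : measurable_fun setT (\1_E : Rn -> R) by exact: measurable_indic.
have r10 : (0 < r + 1)%R by rewrite addr_gt0.
set B := eball x0 (r + 1)%R.
have mB : measurable B by exact: measurable_eball.
pose f k (x : Rn) := (`|avg \1_E (t k) x - \1_E x| `^ p * enorm x `^ alpha)%:E.
pose g (x : Rn) := (2 `^ p * (enorm x `^ alpha * \1_B x))%:E.
have mg : measurable_fun setT g.
  apply/measurable_EFinP; apply: measurable_funM => //; apply: measurable_funM.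
    by apply/measurable_EFinP; exact: measurable_weight.
  exact: measurable_indic.
have g0 x : 0 <= g x by rewrite lee_fin !mulr_ge0// powR_ge0.
have alo' : (- n%:R < alpha)%R.
  apply: le_lt_trans alo; have : (0 <= n%:R * (2^-1 * p) :> R)%R.
    by rewrite mulr_ge0// mulr_ge0// ltW.
  lra.
have ig : mu.-integrable setT g.
  apply/integrableP; split => //.
  under eq_integral do rewrite gee0_abs//.
  have [C C0 HC] := integral_weight_ball alpha alo' a0 (n := n).
  have mW : measurable_fun setT (fun x : Rn => (enorm x `^ alpha * \1_B x)%:E).
    apply/measurable_EFinP; apply: measurable_funM.
      by apply/measurable_EFinP; exact: measurable_weight.
    exact: measurable_indic.
  rewrite (eq_integral (fun x => (2 `^ p)%:E * (enorm x `^ alpha * \1_B x)%:E))//.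
  rewrite ge0_integralZl//; last by move=> x _; rewrite lee_fin mulr_ge0// powR_ge0.
  rewrite lte_mul_pinfty ?lee_fin ?powR_ge0//.
  apply: le_lt_trans (ltry (C * (r + 1) `^ (n%:R + alpha))%R).
  apply: le_trans (HC x0 (r + 1)%R r10).
  rewrite [leRHS]integral_mkcond le_eqVlt; apply/orP; left; apply/eqP.
  apply: eq_integral => x _; rewrite patchE indicE -/B; case: (x \in _).
    by rewrite mulr1.
  by rewrite mulr0.
have mf k : measurable_fun setT (f k).
  by apply: measurable_wpnorm; exact: measurable_dev.
have lim_f : {ae mu, forall x, setT x -> f ^~ x @ \oo --> cst 0 x}.
  apply: filterS tE => x [d d0 Hd] _.
  apply: cvg_near_cst; near=> k; rewrite /f.
  have [tk0 tk1 _] := Ht k.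
  have tkd : (t k <= d)%R.
    apply: (le_trans (ltW tk1)); apply: ltW.
    by near: k; exact: near_infty_natSinv_lt (PosNum d0).
  suff -> : avg \1_E (t k) x = \1_E x.
    by rewrite subrr normr0 powR0 ?gt_eqF// mul0r.
  rewrite /avg (@eq_Rintegral _ _ _ sigma usphere (fun=> \1_E x)); last first.
    move=> w; rewrite inE /usphere/= => w1; rewrite !indicE.
    have -> : (vsub x (vscale (t k) w) \in E) = (x \in E) => //.
    apply/idP/idP; rewrite !inE; apply Hd.
      have -> : vsub x (vsub x (vscale (t k) w)) = vscale (t k) w.
        by apply: eq_from_tnth => i; rewrite !tnth_mktuple subKr.
      by rewrite enorm_vscale w1 mulr1 gtr0_norm.
    have -> : vsub x (vsub x (vscale (t k) w)) = vscale (t k) w.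
      by apply: eq_from_tnth => i; rewrite !tnth_mktuple subKr.
    by rewrite enorm_vscale w1 mulr1 gtr0_norm.
  rewrite Rintegral_cst; last exact: measurable_usphere.
  by rewrite [X in fine X]sphere_measure_usphere//= mulr1.
have dom : {ae mu, forall x k, setT x -> `|f k x| <= g x}.
  apply: aeW => x k _; rewrite gee0_abs; last by rewrite lee_fin mulr_ge0// powR_ge0.
  have [tk0 tk1 _] := Ht k.
  have tk1' : (t k <= 1)%R by rewrite (le_trans (ltW tk1))// invf_le1// ler1n.
  have [xB|xB] := pselect (B x).
    have -> : g x = (2 `^ p * enorm x `^ alpha)%:E by rewrite /g indicE mem_set// mulr1.
    rewrite /f lee_fin; apply: ler_wpM2r; first exact: powR_ge0.
    apply: ge0_ler_powR; rewrite ?nnegrE ?(ltW p0)//.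
    rewrite (le_trans (ler_normB _ _))// -[leRHS]/(1 + 1)%R lerD//.
      by rewrite -lee_fin (le_trans (avg_le _ _ _ mi))// sphabs_indic_le.
    by rewrite indicE; case: (_ \in _); rewrite ?normr1 ?normr0.
  suff -> : f k x = 0 by [].
  have xK y : ~ K y -> (\1_E y : R) = 0%R.
    by move=> yK; rewrite indicE memNset// => /EK.
  have : `|avg \1_E (t k) x|%:E <= 0.
    rewrite (le_trans (avg_le _ _ _ mi))// /sphabs.
    rewrite (sph_support _ x0 r (t k) x xK (ltW tk0))// => xK'; apply: xB.
    by apply: (le_trans xK'); rewrite lerD2l.
  rewrite lee_fin normr_le0 => /eqP h.
  rewrite /f h xK; first by rewrite subrr normr0 powR0 ?gt_eqF// mul0r.
  by move=> xK'; apply: xB; apply: (le_trans xK'); rewrite lerDl.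
have [_ _] := dominated_convergence measurableT mf (measurable_cst _) lim_f ig dom.
rewrite integral0 => cv.
have : e%:E <= 0.
  have <- := cvg_lim (@ereal_hausdorff R) cv.
  apply: lime_ge; first by apply/cvg_ex; exists 0.
  by apply: nearW => k; have [] := Ht k.
by rewrite leNgt lte_fin e0.
Unshelve. all: by end_near. Qed.

(** Half-spaces are continuity sets, and they generate the Borel sets. *)
Lemma measurable_sub_continuity_sets : (@measurable _ Rn) `<=` <<s (@continuity_set R n) >>.
Proof.
have mi (i : 'I_n) : measurable_fun [set: g_sigma_algebraType (@continuity_set R n)]
    ((fun x => tnth x i) : g_sigma_algebraType (@continuity_set R n) -> measurableTypeR R).
  apply: (measurability _ (RGenInftyO.measurableE R)).
  move=> _ [_ [c ->] <-]; rewrite setTI; apply: sub_sigma_algebra.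
  rewrite (_ : _ @^-1` _ = [set x : Rn | (tnth x i < c)%R]); last first.
    by apply/seteqP; split => x /=; rewrite in_itv.
  exact: continuity_set_halfspace.
apply: smallest_sub; first exact: smallest_sigma_algebra.
move=> A /=; rewrite -bigcup_seq => -[i _ [B mB <-]].
exact: (mi i measurableT B mB).
Qed.

Lemma mean_cvg_continuity_set (E : set Rn) : continuity_set E -> mean_cvg (\1_(E `&` K)).
Proof.
move=> tE; have [mE _] := tE; split; first exact: L2_on_indic.
apply: dev_indic_tends0; last exact: subIsetr.
by apply: continuity_setI => //; exact: continuity_set_eball.
Qed.

(** The pi-lambda theorem: differences are handled by linearity, and increasing
    unions by L^2 closure, since the sets are cut down to a ball of finite
    measure. *)
Lemma mean_cvg_indic (E : set Rn) : measurable E -> mean_cvg (\1_(E `&` K)).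
Proof.
have mK : measurable K := measurable_eball x0 r.
have Kfin : mu K < +oo by rewrite lebesgue_Rn_ball// ltry.
pose H (E : set Rn) := measurable E /\ mean_cvg (\1_(E `&` K)).
suff HT : <<s (@continuity_set R n) >> `<=` H by move=> /measurable_sub_continuity_sets /HT[].
have GH : @continuity_set R n `<=` H by move=> A tA; split; [case: tA|exact: mean_cvg_continuity_set].
suff L : lambda_system setT H by exact: (lambda_system_subset continuity_setI L GH).
split; first by [].
- split; first exact: measurableT.
  apply: mean_cvg_continuity_set; split; first exact: measurableT.
  by apply: aeW => x; exists 1%R.
- move=> A B BA [mA gA] [mB gB]; split; first exact: measurableD.
  rewrite (_ : \1_(_) = fun x => \1_(A `&` K) x + (-1) * \1_(B `&` K) x)%R.
    exact: (gD gA (gZ gB)).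
  apply/funext => x; rewrite !indicE in_setI in_setD !in_setI.
  have : (x \in B) ==> (x \in A) by apply/implyP; rewrite !inE; exact: BA.
  by case: (x \in A); case: (x \in B); case: (x \in K) => //= _; lra.
- move=> F ndF HF; have mF k : measurable (F k) by case: (HF k).
  have mU : measurable (\bigcup_i F i) by exact: bigcupT_measurable.
  split => //; apply: mean_cvg_approx => //; first exact: L2_on_indic.
  move=> e e0.
  pose G k := (\bigcup_i F i `\` F k) `&` K.
  have mG k : measurable (G k) by apply: measurableI => //; exact: measurableD.
  have G0 : \bigcap_k G k = set0.
    apply/seteqP; split => // x Gx.
    have [[[k _ Fk] _] _] := Gx 0%N I.
    by have [[_ /(_ Fk)]] := Gx k I.
  have : mu \o G @ \oo --> mu (\bigcap_k G k).
    apply: nonincreasing_cvg_mu => //.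
    - apply: le_lt_trans Kfin; apply: le_measure; rewrite ?inE//.
      exact: subIsetr.
    - by rewrite G0.
    - move=> i j ij; apply/subsetPset; apply: setSI; apply: setDS.
      exact/subsetPset/ndF.
  rewrite G0 measure0 => /fine_cvgP[Gf /cvgrPdist_lt/(_ (e ^+ 2)%R)].
  rewrite exprn_gt0// => /(_ isT) Gc.
  have [k [kf kc]] : exists k, mu (G k) \is a fin_num /\
      (`|0 - fine (mu (G k))| < e ^+ 2)%R.
    have [k _ Hk] := filterI Gf Gc.
    by exists k; have [] := Hk k (leqnn k).
  exists (\1_(F k `&` K)); first by case: (HF k).
  rewrite (eq_integral (fun x => (\1_(G k) x)%:E)); last first.
    move=> x _; congr EFin; rewrite !indicE /G in_setI [in RHS]in_setI in_setD in_setI.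
    have : (x \in F k) ==> (x \in \bigcup_i F i).
      by apply/implyP; rewrite !inE => Fk; exists k.
    by case: (x \in F k); case: (x \in \bigcup_i _); case: (x \in K) => //= _; lra.
  rewrite integral_indic// setIT -[X in X <= _]fineK// lee_fin ltW//.
  by move: kc; rewrite sub0r normrN ger0_norm// fine_ge0.
Qed.

Lemma mean_cvg_sum (I : Type) (s : seq I) (F : I -> Rn -> R) :
  (forall i, mean_cvg (F i)) -> mean_cvg (fun x => \sum_(i <- s) F i x)%R.
Proof.
move=> gF; elim: s => [|i s IH].
  rewrite (_ : (fun x => _) = fun x => 0 * \1_(set0 `&` K) x)%R.
    exact: (gZ (mean_cvg_indic _ measurable0)).
  by apply/funext => x; rewrite big_nil mul0r.
rewrite (_ : (fun x => _) = fun x => F i x + \sum_(j <- s) F j x)%R.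
  exact: (gD (gF i) IH).
by apply/funext => x; rewrite big_cons.
Qed.

Import HBNNSimple.

Lemma mean_cvg_nnsfun (h : {nnsfun Rn >-> R}) : (forall x, ~ K x -> h x = 0%R) -> mean_cvg h.
Proof.
move=> sh.
rewrite (_ : (h : Rn -> R) = fun x =>
    \sum_(y <- finmap.enum_fset (fset_set (range h))) y * \1_(h @^-1` [set y] `&` K) x)%R.
  apply: (mean_cvg_sum _ _ (fun y x => y * \1_(h @^-1` [set y] `&` K) x)%R) => y.
  by apply: gZ; exact: mean_cvg_indic.
apply/funext => x; have [xK|xK] := pselect (K x).
  rewrite {1}(fimfunE h x) fsbig_finite//=; apply: eq_bigr => y _.
  by rewrite !indicE in_setI (mem_set xK) andbT.
rewrite sh// big1// => y _.
by rewrite indicE memNset ?mulr0// => -[].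
Qed.

(** An increasing sequence of simple functions converges to v in L^2, by dominated
    convergence with bound v^2. *)
Lemma mean_cvg_nneg (v : Rn -> R) : L2_on v -> (forall x, 0 <= v x)%R -> mean_cvg v.
Proof.
move=> av v0; have [mv sv iv] := av; apply: mean_cvg_approx => // e e0.
have mvE : measurable_fun setT (EFin \o v) by apply/measurable_EFinP.
pose g := nnsfun_approx measurableT mvE.
have cg x : (g k x)%:E @[k --> \oo] --> (v x)%:E.
  by apply: (cvg_nnsfun_approx measurableT mvE) => // y _; rewrite lee_fin.
have gv k x : (g k x <= v x)%R.
  have /fine_cvgP[_ c1] := cg x.
  have <- : limn (fun k => g k x) = v x by exact: (cvg_lim (@Rhausdorff R) c1).
  apply: (nondecreasing_cvgn_le (u_ := fun k => g k x)).
    by move=> i j ij; exact/lefP/nd_nnsfun_approx.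
  by apply/cvg_ex; exists (v x).
pose f k x := ((v x - g k x) ^+ 2)%:E.
have mf k : measurable_fun setT (f k).
  by apply: measurable_sqrE; exact: measurable_funB.
have lim_f : {ae mu, forall x, setT x -> f ^~ x @ \oo --> cst 0 x}.
  apply: aeW => x _.
  have /fine_cvgP[_ c1] := cg x.
  apply/fine_cvgP; split; first by apply: nearW.
  rewrite /comp/= (_ : 0%R = (v x - v x) ^+ 2)%R; last by rewrite subrr expr0n.
  have c2 : (v x - g k x)%R @[k --> \oo] --> (v x - v x)%R.
    by apply: cvgB => //; exact: cvg_cst.
  exact: (cvg_comp _ _ c2 (@exprn_continuous R 2 (v x - v x)%R)).
have dom : {ae mu, forall x k, setT x -> `|f k x| <= (v x ^+ 2)%:E}.
  apply: aeW => x k _; rewrite gee0_abs; last by rewrite lee_fin sqr_ge0.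
  rewrite lee_fin lerXn2r ?nnegrE ?subr_ge0 ?v0 ?gv// gerBl//.
have ig : mu.-integrable setT (fun x => (v x ^+ 2)%:E).
  apply/integrableP; split; first exact: measurable_sqrE.
  by under eq_integral do rewrite gee0_abs ?lee_fin ?sqr_ge0//.
have [_ _] := dominated_convergence measurableT mf (measurable_cst _) lim_f ig dom.
rewrite integral0 => /fine_cvgP[Gf /cvgrPdist_lt/(_ (e ^+ 2)%R)].
rewrite exprn_gt0// => /(_ isT) Gc.
have [k _ Hk] := filterI Gf Gc; have [kf kc] := Hk k (leqnn k).
exists (g k).
  apply: mean_cvg_nnsfun => x xK; apply: le_anti; rewrite fun_ge0 andbT.
  by rewrite (le_trans (gv k x))// sv.
rewrite -[X in X <= _]fineK// lee_fin ltW//.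
move: kc; rewrite /= sub0r normrN ger0_norm// fine_ge0//.
by apply: integral_ge0 => x _; rewrite lee_fin sqr_ge0.
Qed.

Lemma L2_on_mean_cvg (v : Rn -> R) : L2_on v -> mean_cvg v.
Proof.
move=> [mv sv iv].
have apm (w : Rn -> R) : measurable_fun setT w -> (forall x, 0 <= w x <= `|v x|)%R -> L2_on w.
  move=> mw wv; split => //.
    by move=> x /sv vx; have := wv x; rewrite vx normr0 => h; apply: le_anti; rewrite andbC.
  apply: le_lt_trans iv; apply: ge0_le_integral => //.
  - by move=> x _; rewrite lee_fin sqr_ge0.
  - exact: measurable_sqrE.
  - exact: measurable_sqrE.
  - move=> x _; rewrite lee_fin -[leRHS]real_normK ?num_real//.
    by have /andP[w0 w1] := wv x; rewrite lerXn2r ?nnegrE.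
have g1 : mean_cvg (fun x => Num.max (v x) 0)%R.
  apply: mean_cvg_nneg; last by move=> x; rewrite le_max lexx orbT.
  apply: apm; first exact: measurable_maxr.
  by move=> x; rewrite le_max lexx orbT/= ge_max ler_norm normr_ge0.
have g2 : mean_cvg (fun x => Num.max (- v x) 0)%R.
  apply: mean_cvg_nneg; last by move=> x; rewrite le_max lexx orbT.
  apply: apm; first by apply: measurable_maxr => //; exact: measurableT_comp.
  by move=> x; rewrite le_max lexx orbT/= ge_max -normrN ler_norm normr_ge0.
rewrite (_ : v = fun x => Num.max (v x) 0 + (-1) * Num.max (- v x) 0)%R.
  exact: (gD g1 (gZ g2)).
apply/funext => x; rewrite mulN1r; have [h|h] := leP (v x) 0%R.
  by rewrite max_l ?oppr_ge0// add0r opprK.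
by rewrite max_r ?oppr_le0 ?ltW// subr0.
Qed.

End convergence.

(** * Integrals of functions that may not be measurable *)

Section nonmeasurable.
Context {d : measure_display} {T : measurableType d} {R : realType}.
Variable m : {measure set T -> \bar R}.
Local Open Scope ereal_scope.

Import HBNNSimple.

(** The integral of G is a supremum over the simple functions below G, each of
    which is measurable and almost everywhere below H. *)
Lemma integral_le_ae (N : set T) (G H : T -> \bar R) : measurable N -> m N = 0 ->
  (forall x, 0 <= G x) -> (forall x, 0 <= H x) -> measurable_fun setT H ->
  (forall x, ~ N x -> G x <= H x) -> \int[m]_x G x <= \int[m]_x H x.
Proof.
move=> mN N0 G0 H0 mH GH; rewrite ge0_integralTE//.
apply: ge_ereal_sup => _ [h hG <-].
rewrite -integralT_nnsfun; apply: ae_ge0_le_integral => //.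
- by move=> x _; rewrite lee_fin.
- exact/measurable_EFinP.
- exists N; split => // x /=; apply: contra_notP => Nx _.
  exact: le_trans (hG x) (GH x Nx).
Qed.

Lemma integral_le_nonmeasurable (G H : T -> \bar R) :
  (forall x, 0 <= H x) -> (forall x, H x <= G x) -> \int[m]_x H x <= \int[m]_x G x.
Proof.
move=> H0 HG; have G0 x : 0 <= G x by exact: le_trans (H0 x) (HG x).
rewrite !ge0_integralTE//; apply: le_ereal_sup => _ [h hH <-].
by exists h => // x; exact: le_trans (hH x) (HG x).
Qed.

(** One inequality is integral_le_ae; for the other, cutting g off on N gives a
    measurable function below f with the same integral as g. *)
Lemma eq_integral_ae (N : set T) (f g : T -> \bar R) : measurable N -> m N = 0 ->
  measurable_fun setT g -> (forall x, ~ N x -> f x = g x) ->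
  \int[m]_x f x = \int[m]_x g x.
Proof.
move=> mN N0 mg fg.
have ge0 (f' g' : T -> \bar R) : (forall x, 0 <= f' x) -> (forall x, 0 <= g' x) ->
    measurable_fun setT g' -> (forall x, ~ N x -> f' x = g' x) ->
    \int[m]_x f' x = \int[m]_x g' x.
  move=> f0 g0 mg' fg'; apply/eqP; rewrite eq_le; apply/andP; split.
    by apply: (integral_le_ae N) => // x /fg' ->.
  have mr : measurable_fun setT (g' \_ (~` N)).
    apply/(measurable_restrictT g' (measurableC mN)); exact: measurable_funTS.
  apply: (@le_trans _ _ (\int[m]_x (g' \_ (~` N)) x)).
    apply: (integral_le_ae N) => //.
    - by move=> x; rewrite patchE; case: ifP.
    - by move=> x Nx; rewrite patchE mem_set.
  apply: integral_le_nonmeasurable => x; rewrite patchE; case: ifPn => //.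
  by rewrite inE => /fg' ->.
rewrite integralE [RHS]integralE; congr (_ - _); apply: ge0 => //.
- exact: measurable_funepos.
- by move=> x /fg; rewrite !funeposE => ->.
- exact: measurable_funeneg.
- by move=> x /fg; rewrite !funenegE => ->.
Qed.

End nonmeasurable.

(** * Powers of sums, and Tannery's theorem *)

Section power_sum.
Context {R : realType}.
Variable p : R.
Hypothesis p0 : 0 < p.

(** Each term satisfies a <= m^(1-p) a^p, where m is the whole sum. *)
Lemma powR_sum_le1 (N : nat) (a : nat -> R) : p <= 1 -> (forall k, 0 <= a k) ->
  (\sum_(0 <= k < N) a k) `^ p <= \sum_(0 <= k < N) a k `^ p.
Proof.
move=> p1 a0; set m := \sum_(0 <= k < N) a k.
have s0 : 0 <= \sum_(0 <= k < N) a k `^ p by apply: sumr_ge0 => k _; exact: powR_ge0.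
have m0 : 0 <= m by apply: sumr_ge0.
have [->|mn0] := eqVneq m 0; first by rewrite powR0// gt_eqF.
have mp : 0 < m by rewrite lt_neqAle eq_sym mn0.
have am k : (0 <= k < N)%N -> a k <= m.
  move=> kN; rewrite /m (bigD1_seq k) ?mem_index_iota ?iota_uniq//= lerDl.
  by apply: sumr_ge0.
have h : m <= m `^ (1 - p) * \sum_(0 <= k < N) a k `^ p.
  rewrite mulr_sumr {1}/m big_seq [leRHS]big_seq; apply: ler_sum => k.
  rewrite mem_index_iota => kN.
  have [->|an0] := eqVneq (a k) 0; first by rewrite mulr_ge0// powR_ge0.
  have ap : 0 < a k by rewrite lt_neqAle eq_sym an0 a0.
  have e : a k = a k `^ (1 - p) * a k `^ p by rewrite -powRD ?an0 ?implybT// subrK powRr1.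
  rewrite {1}e; apply: ler_wpM2r; first exact: powR_ge0.
  by apply: ge0_ler_powR; rewrite ?nnegrE ?subr_ge0//; exact: am.
have e : m = m `^ (1 - p) * m `^ p by rewrite -powRD ?mn0 ?implybT// subrK powRr1.
by rewrite {1}e ler_pM2l// in h; exact: powR_gt0.
Qed.

Lemma powR_sum_ge1 (N : nat) (c z : nat -> R) (L : R) : 1 <= p -> 0 < L ->
  (forall k, 0 <= c k) -> (forall k, 0 <= z k) -> \sum_(0 <= k < N) c k <= L ->
  (\sum_(0 <= k < N) c k * z k) `^ p <=
    2 * (2 * L) `^ (p - 1) * \sum_(0 <= k < N) c k * z k `^ p.
Proof.
move=> p1 L0 c0 z0 cL; set m := \sum_(0 <= k < N) c k * z k.
set S := \sum_(0 <= k < N) _.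
have S0 : 0 <= S by apply: sumr_ge0 => k _; rewrite mulr_ge0// powR_ge0.
have m0 : 0 <= m by apply: sumr_ge0 => k _; rewrite mulr_ge0.
have L2 : 0 < 2 * L by rewrite mulr_gt0.
have [->|mn0] := eqVneq m 0.
  by rewrite powR0 ?gt_eqF// !mulr_ge0// powR_ge0.
have mp : 0 < m by rewrite lt_neqAle eq_sym mn0.
(* the terms with z k <= y contribute at most y L = m / 2 to the sum, and in the
   others z k is at most y^(1-p) (z k)^p *)
set y := m / (2 * L); have y0 : 0 < y by rewrite divr_gt0.
have h : m <= y * L + y `^ (1 - p) * S.
  apply: (@le_trans _ _ (\sum_(0 <= k < N) (c k * y + y `^ (1 - p) * (c k * z k `^ p)))).
    apply: ler_sum => k _.
    have -> : c k * y + y `^ (1 - p) * (c k * z k `^ p) =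
      c k * (y + y `^ (1 - p) * z k `^ p) by ring.
    apply: ler_wpM2l => //.
    have [zy|yz] := leP (z k) y.
      by rewrite (le_trans zy)// lerDl mulr_ge0// powR_ge0.
    have zp : 0 < z k by exact: lt_trans yz.
    have e : z k = z k `^ (1 - p) * z k `^ p.
      by rewrite -powRD ?(gt_eqF zp) ?implybT// subrK powRr1 ?(ltW zp).
    apply: (@le_trans _ _ (y `^ (1 - p) * z k `^ p)); last by rewrite lerDr ltW.
    rewrite {1}e; apply: ler_wpM2r; first exact: powR_ge0.
    by apply: le_powR_npos => //; [rewrite subr_le0|exact: ltW].
  rewrite big_split/= -mulr_suml -mulr_sumr lerD2r mulrC.
  by apply: ler_wpM2l => //; exact: ltW.
have yL : y * L = m / 2 by rewrite /y; field; rewrite gt_eqF.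
have h2 : m / 2 <= y `^ (1 - p) * S by move: h; rewrite yL; lra.
have yE : y `^ (p - 1) * y `^ (1 - p) = 1.
  by rewrite -powRD ?(gt_eqF y0) ?implybT// addrC subrKA subrr powRr0.
have h3 : y `^ (p - 1) * (m / 2) <= S.
  have -> : S = y `^ (p - 1) * (y `^ (1 - p) * S) by rewrite mulrA yE mul1r.
  by apply: ler_wpM2l => //; exact: powR_ge0.
have mE : m `^ p = 2 * (2 * L) `^ (p - 1) * (y `^ (p - 1) * (m / 2)).
  have -> : 2 * (2 * L) `^ (p - 1) * (y `^ (p - 1) * (m / 2)) =
     ((2 * L) `^ (p - 1) * y `^ (p - 1)) * m by field.
  rewrite -powRM ?(ltW L2) ?(ltW y0)// /y mulrC mulrCA divff ?gt_eqF// mulr1.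
  by rewrite mulr_powRB1.
rewrite mE; apply: ler_wpM2l => //; rewrite mulr_ge0// powR_ge0//.
Qed.

Local Open Scope ereal_scope.

(** Subadditivity of the power p for p <= 1, and a weighted Jensen inequality with
    a lossy constant for p > 1.  The passage to infinite sums goes through the
    power 1/p, so that no continuity of the power is used. *)
Lemma poweR_nneseries_le (c : nat -> R) : (forall k, 0 <= c k)%R ->
  \sum_(0 <= k <oo) (c k `^ Num.min p 1)%:E < +oo ->
  exists2 A : R, (0 < A)%R & forall y : nat -> \bar R, (forall k, 0 <= y k) ->
    (\sum_(0 <= k <oo) (c k)%:E * y k) `^ p <=
      A%:E * \sum_(0 <= k <oo) (c k `^ Num.min p 1)%:E * (y k) `^ p.
Proof.
move=> c0 cfin; set b := (Num.min p 1)%R in cfin *.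
have b0 : (0 < b)%R by rewrite lt_min p0 ltr01.
suff [A A0 HA] : exists2 A : R, (0 < A)%R & forall (N : nat) (z : nat -> R),
    (forall k, 0 <= z k)%R ->
    ((\sum_(0 <= k < N) c k * z k) `^ p <= A * \sum_(0 <= k < N) c k `^ b * z k `^ p)%R.
  exists A => // y y0.
  set S := (X in _ <= _ * X).
  have t0 k : 0 <= (c k `^ b)%:E * (y k) `^ p.
    by rewrite mule_ge0 ?poweR_ge0// lee_fin powR_ge0.
  have S0 : 0 <= S by apply: nneseries_ge0 => k _ _; exact: t0.
  have [Sfin|] := ltP S +oo; last first.
    by rewrite leye_eq => /eqP ->; rewrite gt0_muley ?lte_fin// leey.
  pose z k := fine (y k).
  have z0 k : (0 <= z k)%R by rewrite fine_ge0.
  have cz k : (c k)%:E * y k = (c k * z k)%:E.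
    have [->|cn0] := eqVneq (c k) 0%R; first by rewrite mul0e mul0r.
    have ck : (0 < c k)%R by rewrite lt_neqAle eq_sym cn0 c0.
    rewrite EFinM fineK// ge0_fin_numE// ltNge leye_eq; apply/eqP => yoo.
    have : (c k `^ b)%:E * (y k) `^ p <= S by exact: (nneseries_ge_term _ (fun k => (c k `^ b)%:E * (y k) `^ p)).
    rewrite yoo poweRyr ?gt_eqF// gt0_muley ?lte_fin ?powR_gt0// leye_eq => /eqP Soo.
    by rewrite Soo in Sfin.
  have SE k : (c k `^ b * z k `^ p)%:E <= (c k `^ b)%:E * (y k) `^ p.
    rewrite EFinM; apply: lee_wpmul2l; first by rewrite lee_fin powR_ge0.
    by rewrite /z; case: (y k) (y0 k) => [w| |]//= _; rewrite (gt_eqF p0) leey.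
  have P N : \sum_(0 <= k < N) (c k)%:E * y k <= (A%:E * S) `^ p^-1.
    have -> : \sum_(0 <= k < N) (c k)%:E * y k = (\sum_(0 <= k < N) c k * z k)%:E.
      by rewrite -sumEFin; apply: eq_bigr => k _.
    set u := (\sum_(0 <= k < N) c k * z k)%R.
    have u0 : (0 <= u)%R by apply: sumr_ge0 => k _; rewrite mulr_ge0.
    have -> : u%:E = (u%:E `^ p) `^ p^-1.
      by rewrite -poweRrM mulfV ?gt_eqF// poweRe1// lee_fin.
    apply: (gt0_ler_poweR); rewrite ?in_itv/= ?leey ?andbT ?invr_ge0 ?(ltW p0)//.
    - by rewrite lee_fin powR_ge0.
    - by rewrite mule_ge0// lee_fin ltW.
    apply: (@le_trans _ _ (A%:E * (\sum_(0 <= k < N) c k `^ b * z k `^ p)%:E)).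
      by rewrite -EFinM lee_fin; exact: HA.
    apply: lee_wpmul2l; first by rewrite lee_fin ltW.
    apply: (@le_trans _ _ (\sum_(0 <= k < N) (c k `^ b)%:E * (y k) `^ p)).
      by rewrite -sumEFin; apply: lee_sum => k _; exact: SE.
    exact: nneseries_lim_ge.
  have lim : \sum_(0 <= k <oo) (c k)%:E * y k <= (A%:E * S) `^ p^-1.
    apply: lime_le; first by apply: is_cvg_nneseries => k _ _; rewrite mule_ge0// lee_fin.
    exact: nearW.
  have -> : A%:E * S = ((A%:E * S) `^ p^-1) `^ p.
    by rewrite -poweRrM mulVf ?gt_eqF// poweRe1// mule_ge0// lee_fin ltW.
  apply: (gt0_ler_poweR); rewrite ?in_itv/= ?leey ?andbT ?poweR_ge0 ?(ltW p0)//.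
  by apply: nneseries_ge0 => k _ _; rewrite mule_ge0// lee_fin.
have [p1|p1] := leP p 1%R.
  have bE : b = p by rewrite /b min_l.
  exists 1%R => // N z z0; rewrite mul1r bE.
  apply: le_trans (powR_sum_le1 N _ p1 _) _; first by move=> k; rewrite mulr_ge0.
  by apply: ler_sum => k _; rewrite powRM.
have bE : b = 1%R by rewrite /b min_r// ltW.
set L := fine (\sum_(0 <= k <oo) (c k `^ b)%:E).
have t0 k : 0 <= (c k `^ b)%:E by rewrite lee_fin powR_ge0.
have LN N : (\sum_(0 <= k < N) c k <= L + 1)%R.
  apply: (@le_trans _ _ L); last by rewrite lerDl.
  rewrite -lee_fin fineK; last by rewrite ge0_fin_numE//; exact: nneseries_ge0.
  apply: le_trans (nneseries_lim_ge N _) => //.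
  rewrite sumEFin lee_fin; apply: ler_sum => k _.
  by rewrite bE powRr1.
have L0 : (0 <= L)%R by rewrite fine_ge0//; exact: nneseries_ge0.
have L1 : (0 < L + 1)%R by rewrite ltr_wpDl.
exists (2 * (2 * (L + 1)) `^ (p - 1))%R.
  by rewrite mulr_gt0// powR_gt0// mulr_gt0.
move=> N z z0; apply: le_trans (powR_sum_ge1 N c z _ (ltW p1) L1 c0 z0 (LN N)) _.
rewrite le_eqVlt; apply/orP; left; apply/eqP; congr (_ * _)%R.
by apply: eq_bigr => k _; rewrite bE powRr1.
Qed.

(** The tail of the series is small uniformly in t, and the remaining finite sum
    tends to 0. *)
Lemma tends0_nneseries (b : nat -> R) (D : R) (G : nat -> R -> \bar R) :
  (forall k, 0 <= b k)%R -> \sum_(0 <= k <oo) (b k)%:E < +oo -> (0 <= D)%R ->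
  (forall k t, 0 <= G k t) -> (forall k t, (0 < t)%R -> G k t <= D%:E) ->
  (forall k, tends0 (G k)) -> tends0 (fun t => \sum_(0 <= k <oo) (b k)%:E * G k t).
Proof.
move=> b0 bfin D0 G0 GD Gt e e0.
have b0E k : 0 <= (b k)%:E by rewrite lee_fin.
have := nneseries_tail_cvg bfin (fun k _ => b0E k).
move=> /fine_cvgP[Gf /cvgrPdist_lt/(_ (e / (2 * (D + 1)))%R)].
have D1 : (0 < D + 1)%R by rewrite ltr_wpDl.
have e1 : (0 < e / (2 * (D + 1)))%R by rewrite divr_gt0// mulr_gt0.
move=> /(_ e1) Gc.
have [N _ HN] := filterI Gf Gc; have [Nf Nc] := HN N (leqnn N).
have tail : \sum_(N <= k <oo) (b k)%:E <= (e / (2 * (D + 1)))%:E.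
  rewrite -[leLHS]fineK// lee_fin ltW//.
  move: Nc; rewrite /= sub0r normrN ger0_norm// fine_ge0//; exact: nneseries_ge0.
have fin M : tends0 (fun t => \sum_(0 <= k < M) (b k)%:E * G k t).
  elim: M => [|M IH].
    by move=> e' e'0; exists 1%R => // t _ _; rewrite big_nil lee_fin ltW.
  apply: (tends0_le _ (fun t => \sum_(0 <= k < M) (b k)%:E * G k t + (b M)%:E * G M t)).
    by move=> t _; rewrite big_nat_recr.
  by apply: tends0D => //; exact: tends0Z.
have e2 : (0 < e / 2)%R by rewrite divr_gt0.
have [d d0 Hd] := fin N _ e2.
exists d => // t t0 td.
rewrite (nneseries_split 0 N)//; last by move=> k _; rewrite mule_ge0.
rewrite add0n [e]splitr EFinD; apply: leeD; first exact: Hd.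
apply: (@le_trans _ _ (\sum_(N <= k <oo) (D%:E * (b k)%:E))).
  apply: lee_nneseries => k; first by move=> _; rewrite mule_ge0.
  by move=> _; rewrite muleC; apply: lee_wpmul2r => //; exact: GD.
rewrite nneseriesZl//.
apply: (@le_trans _ _ (D%:E * (e / (2 * (D + 1)))%:E)); first by apply: lee_wpmul2l.
rewrite -EFinM lee_fin.
have -> : (D * (e / (2 * (D + 1))) = (e / 2) * (D / (D + 1)))%R by field; rewrite gt_eqF.
by rewrite ger_pMr// ler_pdivrMr// mul1r lerDl.
Qed.

End power_sum.

(** * Superpositions of real blocks *)

Section superposition.
Context {R : realType} {n : nat}.
Local Notation Rn := (n.-tuple R).
Local Notation mu := (lebesgue_Rn R n).
Local Notation sigma := (@sphere_measure R n).
Variables p alpha : R.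
Hypothesis n0 : (0 < n)%N.
Hypothesis p0 : (0 < p)%R.
Hypothesis p2 : (p < 2)%R.
Hypothesis alo : (n%:R * (2^-1 * p - 1) < alpha)%R.
Hypothesis aup : (alpha < n%:R * ((n%:R - 1) / n%:R * p - 1))%R.
Hypothesis a0 : (alpha <= 0)%R.
Local Notation dev := (dev p alpha).
Local Notation s := (alpha + n%:R - n%:R * (p / 2))%R.
Local Open Scope ereal_scope.

(** By Tonelli the means of the indicator of N have integral 0. *)
Lemma sph_null (N : set Rn) t : measurable N -> mu N = 0 ->
  {ae mu, forall x, sigma [set w | N (vsub x (vscale t w))] = 0}.
Proof.
move=> mN N0.
have mi : measurable_fun setT (fun x : Rn => (\1_N x)%:E : \bar R).
  by apply/measurable_EFinP; exact: measurable_indic.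
have i0 (x : Rn) : 0 <= (\1_N x)%:E :> \bar R by rewrite lee_fin.
have ms := measurable_sph n0 (fun x : Rn => (\1_N x)%:E : \bar R) t mi i0.
have : \int[mu]_x `|sph (fun x : Rn => (\1_N x)%:E) t x| = 0.
  under eq_integral do rewrite gee0_abs ?sph_ge0//.
  by rewrite integral_sph// integral_indic// setIT.
move=> /(ae_eq_integral_abs mu measurableT ms).
apply: filterS => x /(_ I); rewrite sphE// /cst => sx.
rewrite -[RHS]sx.
have mP : measurable [set w | N (vsub x (vscale t w))].
  by rewrite -[X in measurable X]setTI; exact: (measurable_shiftr t x).
rewrite -[X in sigma X]setIT -integral_indic//.
Qed.

Lemma weight_pos_ae : {ae mu, forall x : Rn, (0 < enorm x `^ alpha)%R}.
Proof.
exists [set vzero]; split; first exact: measurable_set1_Rn.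
  exact: lebesgue_Rn_set1.
move=> x /=; apply: contra_notP => x0; apply: powR_gt0.
rewrite lt_neqAle enorm_ge0 andbT eq_sym; apply/eqP => /enorm_eq0 xz.
exact: x0.
Qed.

Variables (c : nat -> R) (v : nat -> Rn -> R) (xk : nat -> Rn) (rk : nat -> R) (M : R).
Hypothesis c0 : forall k, (0 <= c k)%R.
Hypothesis cfin : \sum_(0 <= k <oo) (c k `^ Num.min p 1)%:E < +oo.
Hypothesis mv : forall k, measurable_fun setT (v k).
Hypothesis sv : forall k x, ~ eball (xk k) (rk k) x -> v k x = 0%R.
Hypothesis rk0 : forall k, (0 < rk k)%R.
Hypothesis M0 : (0 < M)%R.
Hypothesis iv : forall k,
  \int[mu]_x (v k x ^+ 2)%:E <= ((M * rk k `^ (- (s / p))) ^+ 2)%:E.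

(** The normalisation of blocks is exactly the one that makes the bounds sph_bound
    and dev_bound independent of the ball. *)
Lemma block_scale k : ((M * rk k `^ (- (s / p))) `^ p * rk k `^ s = M `^ p)%R.
Proof.
rewrite powRM ?(ltW M0) ?powR_ge0// -powRrM mulNr divfK ?gt_eqF// -mulrA.
by rewrite -powRD ?(gt_eqF (rk0 k)) ?implybT// addNr powRr0 mulr1.
Qed.

Lemma block_L2_on k : L2_on (xk k) (rk k) (v k).
Proof.
split => //; first exact: sv.
by apply: le_lt_trans (iv k) _; rewrite ltry.
Qed.

(** The p-th power of this sum has a finite weighted integral, by sph_bound and
    poweR_nneseries_le. *)
Lemma dominating_ae t : (0 <= t)%R ->
  {ae mu, forall x, \sum_(0 <= k <oo) (c k)%:E * sphabs (v k) t x < +oo}.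
Proof.
move=> t0.
have [C C0 HC] := sph_bound p alpha n0 p0 p2 alo aup a0.
have [A A0 HA] := poweR_nneseries_le p p0 c c0 cfin.
pose y k x := sphabs (v k) t x.
have y0 k x : 0 <= y k x by exact: sphabs_ge0.
have my k : measurable_fun setT (y k) by exact: measurable_sphabs.
pose S x := \sum_(0 <= k <oo) (c k)%:E * y k x.
have cy0 k x : 0 <= (c k)%:E * y k x by rewrite mule_ge0// lee_fin.
have S0 x : 0 <= S x by apply: nneseries_ge0.
have mS : measurable_fun setT S.
  by apply: measurable_nneseries => // k; exact: measurable_funeM.
pose W (x : Rn) : \bar R := (enorm x `^ alpha)%:E.
have W0 x : 0 <= W x by rewrite lee_fin powR_ge0.
pose q k x := (y k x) `^ p * W x.
have q0 k x : 0 <= q k x by rewrite mule_ge0// poweR_ge0.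
have mpow (f : Rn -> \bar R) : measurable_fun setT f -> measurable_fun setT (fun x => (f x) `^ p * W x).
  move=> mf; apply: emeasurable_funM; last exact: measurable_weight.
  exact: (measurableT_comp (measurable_poweR p) mf).
have mq k : measurable_fun setT (q k) by exact: mpow.
have bq0 k x : 0 <= (c k `^ Num.min p 1)%:E * q k x.
  by rewrite mule_ge0// lee_fin powR_ge0.
have bnd x : (S x) `^ p * W x <= A%:E * \sum_(0 <= k <oo) (c k `^ Num.min p 1)%:E * q k x.
  apply: (@le_trans _ _ (A%:E * (\sum_(0 <= k <oo) (c k `^ Num.min p 1)%:E * (y k x) `^ p) * W x)).
    by apply: lee_wpmul2r => //; exact: HA.
  rewrite -muleA; apply: lee_wpmul2l; first by rewrite lee_fin ltW.
  rewrite muleC /W -nneseriesZl; last by move=> k _; rewrite mule_ge0 ?poweR_ge0// lee_fin powR_ge0.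
  rewrite le_eqVlt; apply/orP; left; apply/eqP; apply: eq_eseriesr => k _.
  by rewrite /q /W muleC muleA.
have mT : measurable_fun setT (fun x => A%:E * \sum_(0 <= k <oo) (c k `^ Num.min p 1)%:E * q k x).
  apply: measurable_funeM; apply: measurable_nneseries => // k.
  exact: measurable_funeM.
have T0 x : 0 <= A%:E * \sum_(0 <= k <oo) (c k `^ Num.min p 1)%:E * q k x.
  by rewrite mule_ge0 ?lee_fin ?(ltW A0)//; apply: nneseries_ge0.
have Sint : \int[mu]_x ((S x) `^ p * W x) < +oo.
  apply: (@le_lt_trans _ _ (\int[mu]_x (A%:E * \sum_(0 <= k <oo) (c k `^ Num.min p 1)%:E * q k x))).
    apply: ge0_le_integral => //; last exact: mpow.
    by move=> x _; rewrite mule_ge0// poweR_ge0.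
  rewrite ge0_integralZl//; last 3 first.
  - by apply: measurable_nneseries => // k; exact: measurable_funeM.
  - by move=> x _; apply: nneseries_ge0.
  - by rewrite lee_fin ltW.
  rewrite integral_nneseries//; last by move=> k; exact: measurable_funeM.
  rewrite lte_mul_pinfty ?lee_fin ?(ltW A0)//.
  apply: (@le_lt_trans _ _ (\sum_(0 <= k <oo) ((C * M `^ p)%:E * (c k `^ Num.min p 1)%:E))).
    apply: lee_nneseries => k _.
      by move=> _; apply: integral_ge0.
    rewrite ge0_integralZl//; last by rewrite lee_fin powR_ge0.
    rewrite muleC; apply: lee_wpmul2r; first by rewrite lee_fin powR_ge0.
    rewrite -(block_scale k).
    have Mk : (0 < M * rk k `^ (- (s / p)))%R by rewrite mulr_gt0// powR_gt0.
    exact: (HC (v k) (xk k) (rk k) t _ (mv k) (sv k) (rk0 k) t0 Mk (iv k)).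
  rewrite nneseriesZl; last by move=> k _; rewrite lee_fin powR_ge0.
  by rewrite lte_mul_pinfty// lee_fin mulr_ge0 ?powR_ge0// ltW.
have : mu.-integrable setT (fun x => (S x) `^ p * W x).
  apply/integrableP; split; first exact: mpow.
  by under eq_integral do rewrite gee0_abs ?mule_ge0 ?poweR_ge0//.
move=> /(integrable_ae measurableT) Sae.
apply: filterS2 Sae weight_pos_ae => x /(_ I) Sx Wx.
rewrite ltNge leye_eq; apply/eqP => Soo; move: Sx.
by rewrite /S Soo poweRyr ?gt_eqF// gt0_mulye ?lte_fin.
Qed.

Variables (F : Rn -> R) (N : set Rn).
Hypothesis mN : measurable N.
Hypothesis N0 : mu N = 0.
Hypothesis cvgF : forall x, ~ N x -> (\sum_(0 <= k < m) c k * v k x)%R @[m --> \oo] --> F x.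

(** The partial sums are dominated on the sphere by an integrable series.  Since F
    is arbitrary on N, it is first replaced by F1, which vanishes on N and is
    measurable as a limit of measurable functions. *)
Lemma avg_cvg t x : \sum_(0 <= k <oo) (c k)%:E * sphabs (v k) t x < +oo ->
  sigma [set w | N (vsub x (vscale t w))] = 0 ->
  (\sum_(0 <= k < m) c k * avg (v k) t x)%R @[m --> \oo] --> avg F t x.
Proof.
move=> Tfin sN.
pose F1 : Rn -> R := F \_ (~` N).
pose Sm m y := (\sum_(0 <= k < m) c k * v k y)%R.
have mSm m : measurable_fun setT (Sm m).
  by apply: measurable_sum => k; exact: measurable_funM.
have mF1 : measurable_fun setT F1.
  apply: (@measurable_fun_cvg _ _ _ setT (fun m => (Sm m) \_ (~` N)) F1).
    move=> m; apply/(measurable_restrictT (Sm m) (measurableC mN)); exact: measurable_funTS.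
  move=> y _; rewrite /F1 [X in _ --> X]patchE.
  under eq_fun do rewrite patchE.
  case: ifPn => [|_]; last exact: cvg_cst.
  by rewrite inE => /cvgF.
pose h w := vsub x (vscale t w).
have mh : measurable_fun setT h := measurable_shiftr t x.
have mE (u : Rn -> R) : measurable_fun setT u -> measurable_fun (@usphere R n) (fun w => (u (h w))%:E).
  by move=> mu_; exact: (measurable_shiftE u t x mu_).
have mNx : measurable [set w | N (h w)].
  by rewrite -[X in measurable X]setTI; exact: mh.
have mU := @measurable_usphere R n.
have avgF : avg F t x = fine (\int[sigma]_(w in usphere) (F1 (h w))%:E).
  rewrite /avg /Rintegral; congr fine; rewrite integral_mkcond [RHS]integral_mkcond.
  apply: (eq_integral_ae sigma _ _ _ mNx) => //.
    apply/(measurable_restrictT (fun w => (F1 (h w))%:E) mU); exact: mE.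
  move=> w Nw; rewrite !patchE; case: ifP => // _.
  by rewrite /F1 patchE mem_set.
have fin k : c k != 0%R -> sphabs (v k) t x < +oo.
  move=> ck; have cp : (0 < c k)%R by rewrite lt_neqAle eq_sym ck c0.
  rewrite ltNge leye_eq; apply/eqP => soo.
  have := nneseries_ge_term _ (fun k => (c k)%:E * sphabs (v k) t x) k.
  rewrite soo gt0_muley ?lte_fin// leye_eq => H.
  have /eqP Too := H (fun k => mule_ge0 (c0 k : 0 <= (c k)%:E) (sphabs_ge0 _ _ _)).
  by rewrite Too in Tfin.
have intk k : sigma.-integrable usphere (fun w => (c k * v k (h w))%:E).
  have [->|ck] := eqVneq (c k) 0%R.
    under eq_fun do rewrite mul0r; exact: integrable0.
  under eq_fun do rewrite EFinM; apply: integrableZl => //.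
  exact: integrable_shift (fin k ck).
have intE m : \int[sigma]_(w in usphere) (Sm m (h w))%:E =
    (\sum_(0 <= k < m) c k * avg (v k) t x)%:E.
  rewrite /Sm; under eq_integral do rewrite -sumEFin.
  rewrite integral_sum//= -sumEFin; apply: eq_bigr => k _.
  have [->|ck] := eqVneq (c k) 0%R.
    by rewrite mul0r; under eq_integral do rewrite mul0r; rewrite integral0.
  under eq_integral do rewrite EFinM.
  have ik := integrable_shift (v k) t x (mv k) (fin k ck).
  rewrite integralZl//= EFinM /avg /Rintegral fineK//.
  exact: integrable_fin_num.
have [] := @dominated_convergence _ _ _ sigma (@usphere R n) mU
  (fun m w => (Sm m (h w))%:E) (fun w => (F1 (h w))%:E)
  (fun w => \sum_(0 <= k <oo) (c k * `|v k (h w)|)%:E).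
- by move=> m; exact: mE.
- exact: mE.
- exists [set w | N (h w)]; split => // w /=; apply: contra_notP => Nw _.
  apply/cvg_EFin; first exact: nearW.
  rewrite /comp/= /F1 patchE mem_set//; exact: cvgF.
- have q0 k w : 0 <= (c k * `|v k (h w)|)%:E by rewrite lee_fin mulr_ge0.
  have mq k : measurable_fun (@usphere R n) (fun w => (c k * `|v k (h w)|)%:E).
    apply: (mE (fun y => c k * `|v k y|)%R); apply: measurable_funM => //.
    exact: measurableT_comp.
  apply/integrableP; split.
    exact: (@ge0_emeasurable_sum _ _ _ usphere (fun k w => (c k * `|v k (h w)|)%:E) xpredT).
  under eq_integral do rewrite gee0_abs ?nneseries_ge0//.
  rewrite integral_nneseries//.
  apply: le_lt_trans Tfin; apply: lee_nneseries => k _; first by move=> _; apply: integral_ge0.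
  under eq_integral do rewrite EFinM.
  rewrite ge0_integralZl//; last by rewrite lee_fin.
  exact: (mE (fun y => `|v k y|%R) (measurableT_comp _ (mv k))).
- apply: aeW => w m _; rewrite /= (@le_trans _ _ (\sum_(0 <= k < m) (c k * `|v k (h w)|)%:E))//.
    rewrite sumEFin lee_fin (le_trans (ler_norm_sum _ _ _))//; apply: ler_sum => k _.
    by rewrite normrM (ger0_norm (c0 k)).
  by apply: nneseries_lim_ge => k _ _; rewrite lee_fin mulr_ge0.
move=> iF _; rewrite -[X in _ --> X -> _]fineK; last exact: integrable_fin_num iF.
move=> /fine_cvg cv; rewrite avgF.
rewrite (_ : (fun m => _) = fine \o (fun m => \int[sigma]_(w in usphere) (Sm m (h w))%:E))//.
by apply/funext => m /=; rewrite intE.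
Qed.

Lemma avg_sub_le_nneseries t x : ~ N x ->
  \sum_(0 <= k <oo) (c k)%:E * sphabs (v k) t x < +oo ->
  sigma [set w | N (vsub x (vscale t w))] = 0 ->
  `|avg F t x - F x|%:E <= \sum_(0 <= k <oo) (c k)%:E * `|avg (v k) t x - v k x|%:E.
Proof.
move=> Nx Tfin sN.
have c1 := avg_cvg t x Tfin sN.
have c2 := cvgF x Nx.
have c3 : (\sum_(0 <= k < m) c k * (avg (v k) t x - v k x))%R @[m --> \oo] --> (avg F t x - F x)%R.
  rewrite (_ : (fun m => _) = fun m => (\sum_(0 <= k < m) c k * avg (v k) t x -
      \sum_(0 <= k < m) c k * v k x)%R); first exact: cvgB.
  by apply/funext => m; rewrite -sumrB; apply: eq_bigr => k _; rewrite mulrBr.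
have c4 : (`|\sum_(0 <= k < m) c k * (avg (v k) t x - v k x)|)%R @[m --> \oo] -->
    (`|avg F t x - F x|)%R by exact: cvg_norm c3.
set Z := (X in _ <= X).
have bnd m : (`|\sum_(0 <= k < m) c k * (avg (v k) t x - v k x)|%R)%:E <= Z.
  apply: (@le_trans _ _ (\sum_(0 <= k < m) (c k)%:E * `|avg (v k) t x - v k x|%:E)).
    rewrite (eq_bigr (fun k => (c k * `|avg (v k) t x - v k x|)%:E))//.
    rewrite sumEFin lee_fin (le_trans (ler_norm_sum _ _ _))//; apply: ler_sum => k _.
    by rewrite normrM (ger0_norm (c0 k)).
  by apply: nneseries_lim_ge => k _ _; rewrite mule_ge0// lee_fin.
have : 0 <= Z by apply: nneseries_ge0 => k _ _; rewrite mule_ge0// lee_fin.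
move: Z bnd => [z| |] bnd // _; last by rewrite leey.
rewrite lee_fin.
have <- := cvg_lim (@Rhausdorff R) c4.
apply: limr_le; first by apply/cvg_ex; eexists; exact: c4.
by apply: nearW => m; rewrite -lee_fin.
Qed.

(** As the deviation of F may be the integral of a non-measurable function, and
    such integrals are not subadditive, the statement provides a measurable
    majorant H whose integrals can be added. *)
Lemma tends0_superposition : exists H : R -> Rn -> \bar R,
  [/\ forall t x, 0 <= H t x,
      forall t, measurable_fun setT (H t),
      forall t, (0 < t)%R ->
        {ae mu, forall x, (`|avg F t x - F x| `^ p * enorm x `^ alpha)%:E <= H t x} &
      tends0 (fun t => \int[mu]_x H t x)].
Proof.
have [C C0 HC] := dev_bound p alpha n0 p0 p2 alo aup a0.
have [A A0 HA] := poweR_nneseries_le p p0 c c0 cfin.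
have dk k t : (0 < t)%R -> dev (v k) t <= (C * M `^ p)%:E.
  move=> t0; rewrite -(block_scale k).
  have Mk : (0 < M * rk k `^ (- (s / p)))%R by rewrite mulr_gt0// powR_gt0.
  exact: (HC (v k) (xk k) (rk k) t _ (mv k) (sv k) (rk0 k) (ltW t0) Mk (iv k)).
pose W (x : Rn) : R := (enorm x `^ alpha)%R.
pose q t k (x : Rn) := (`|avg (v k) t x - v k x| `^ p * W x)%:E.
have q0 t k x : 0 <= q t k x by rewrite lee_fin mulr_ge0// powR_ge0.
have mq t k : measurable_fun setT (q t k) by apply: measurable_wpnorm; exact: measurable_dev.
have cq0 t k x : 0 <= (c k `^ Num.min p 1)%:E * q t k x by rewrite mule_ge0// lee_fin powR_ge0.
have mcq t k : measurable_fun setT (fun x => (c k `^ Num.min p 1)%:E * q t k x) by exact: measurable_funeM.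
pose H t x := A%:E * \sum_(0 <= k <oo) (c k `^ Num.min p 1)%:E * q t k x.
have S0 t x : 0 <= \sum_(0 <= k <oo) (c k `^ Num.min p 1)%:E * q t k x.
  by apply: nneseries_ge0 => k _ _; exact: cq0.
have mS t := measurable_nneseries _ _ _ _ (cq0 t) (mcq t).
have H0 t x : 0 <= H t x by rewrite mule_ge0// lee_fin ltW.
have mH t : measurable_fun setT (H t) by exact: measurable_funeM.
have HE t : \int[mu]_x H t x = A%:E * \sum_(0 <= k <oo) (c k `^ Num.min p 1)%:E * dev (v k) t.
  rewrite ge0_integralZl//; last by rewrite lee_fin ltW.
  rewrite integral_nneseries//; congr (_ * _); apply: eq_eseriesr => k _.
  by rewrite ge0_integralZl// lee_fin powR_ge0.
exists H; split => //; last first.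
  apply: (tends0_le _ (fun t => A%:E * \sum_(0 <= k <oo) (c k `^ Num.min p 1)%:E * dev (v k) t)).
    by move=> t _; rewrite HE.
  apply: tends0Z; first exact: ltW.
  apply: (tends0_nneseries _ (C * M `^ p)%R) => //.
  - by move=> k; exact: powR_ge0.
  - by rewrite mulr_ge0 ?powR_ge0// ltW.
  - by move=> k t; exact: dev_ge0.
  - move=> k; have [_ cvk] := L2_on_mean_cvg p alpha n0 p0 p2 alo aup a0
      (xk k) (rk k) (rk0 k) (v k) (block_L2_on k).
    exact: cvk.
move=> t t0.
have Nae : {ae mu, forall x, ~ N x} by exists N; split => // x /= /contrapT.
apply: filterS3 Nae (dominating_ae t (ltW t0)) (sph_null N t mN N0) => x Nx T1 T2.
have h1 := avg_sub_le_nneseries t x Nx T1 T2.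
rewrite EFinM /H.
apply: (@le_trans _ _ ((A%:E * \sum_(0 <= k <oo) (c k `^ Num.min p 1)%:E *
    (`|avg (v k) t x - v k x|%:E) `^ p) * (W x)%:E)).
  apply: lee_wpmul2r; first by rewrite lee_fin powR_ge0.
  apply: le_trans (HA _ _); last by move=> k; rewrite lee_fin.
  rewrite -poweR_EFin; apply: (gt0_ler_poweR (ltW p0)) => //; rewrite in_itv/= ?leey ?andbT ?lee_fin//.
  by apply: nneseries_ge0 => k _ _; rewrite mule_ge0// lee_fin.
rewrite -muleA; apply: lee_wpmul2l; first by rewrite lee_fin ltW.
rewrite muleC -nneseriesZl; last by move=> k _; rewrite mule_ge0 ?poweR_ge0// lee_fin powR_ge0.
rewrite le_eqVlt; apply/orP; left; apply/eqP; apply: eq_eseriesr => k _.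
by rewrite /q EFinM poweR_EFin muleC muleA.
Qed.

End superposition.

(** * Complex-valued functions *)

Section complex_modulus.
Context {R : realType}.
Implicit Types z w : R[i].

Lemma cabs_ge0 z : 0 <= cabs z.
Proof. by case: z => a b; exact: sqrtr_ge0. Qed.

Lemma cabsM z w : cabs (z * w) = cabs z * cabs w.
Proof. exact: Normc.normcM. Qed.

Lemma cabsE z : cabs z = Num.sqrt (complex.Re z ^+ 2 + complex.Im z ^+ 2).
Proof. by case: z. Qed.

Lemma normr_Re_le z : `|complex.Re z| <= cabs z.
Proof. by rewrite cabsE -sqrtr_sqr ler_wsqrtr// lerDl sqr_ge0. Qed.

Lemma normr_Im_le z : `|complex.Im z| <= cabs z.
Proof. by rewrite cabsE -sqrtr_sqr ler_wsqrtr// lerDr sqr_ge0. Qed.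

Lemma cabs_le_ReIm z : cabs z <= `|complex.Re z| + `|complex.Im z|.
Proof.
rewrite cabsE -[leRHS]ger0_norm ?addr_ge0// -sqrtr_sqr ler_wsqrtr//.
rewrite sqrrD !real_normK ?num_real// addrAC lerDl.
by rewrite mulrn_wge0// mulr_ge0.
Qed.

Lemma powR_cabs_le p z : 0 < p ->
  cabs z `^ p <= 2 `^ p * (`|complex.Re z| `^ p + `|complex.Im z| `^ p).
Proof.
move=> p0.
have := powR_normD_le p p0 `|complex.Re z| `|complex.Im z|.
rewrite !normr_id; apply: le_trans.
apply: ge0_ler_powR; rewrite ?nnegrE ?(ltW p0) ?cabs_ge0//.
by rewrite ger0_norm ?addr_ge0// cabs_le_ReIm.
Qed.

End complex_modulus.

Section main.
Context {R : realType} {n : nat}.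
Local Notation Rn := (n.-tuple R).
Local Notation mu := (lebesgue_Rn R n).
Variables p alpha : R.
Hypothesis n0 : (0 < n)%N.
Hypothesis p0 : (0 < p)%R.
Hypothesis p2 : (p < 2)%R.
Hypothesis alo : (n%:R * (2^-1 * p - 1) < alpha)%R.
Hypothesis aup : (alpha < n%:R * ((n%:R - 1) / n%:R * p - 1))%R.
Hypothesis a0 : (alpha <= 0)%R.
Local Notation s := (alpha + n%:R - n%:R * (p / 2))%R.
Local Open Scope ereal_scope.

(** The volume of the ball is r^n times a constant, and n times the exponent in the
    definition of a block is -s/p. *)
Lemma block_sqr_le (a : Rn -> R[i]) (x0 : Rn) (r : R) : (0 < r)%R ->
  'N[mu]_2%:E [EFin \o (cabs \o a)] <=
     mu (eball x0 r) `^ (- (alpha / (p * n%:R)) - p^-1 + fine ((2%:E : \bar R)^-1)) ->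
  \int[mu]_x (cabs (a x) ^+ 2)%:E <=
    ((vol1 (R := R) (n := n) `^ (- (alpha / (p * n%:R)) - p^-1 + 2^-1) *
      r `^ (- (s / p))) ^+ 2)%:E.
Proof.
move=> r0; rewrite inver pnatr_eq0/=.
set e := (_ - _ + _)%R => h.
have w0 := @vol1_gt0 R n.
have -> : \int[mu]_x (cabs (a x) ^+ 2)%:E = ('N[mu]_2%:E [EFin \o (cabs \o a)]) `^ 2.
  rewrite poweR_Lnorm//; apply: eq_integral => x _ /=.
  by rewrite ger0_norm ?cabs_ge0// (powR_mulrn 2)// cabs_ge0.
apply: (@le_trans _ _ ((mu (eball x0 r) `^ e) `^ 2)).
  by apply: gt0_ler_poweR => //; rewrite in_itv/= ?leey ?andbT ?poweR_ge0 ?Lnorm_ge0.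
rewrite lebesgue_Rn_ball//= lee_fin (powR_mulrn 2) ?powR_ge0//.
rewrite le_eqVlt; apply/orP; left; apply/eqP; congr (_ ^+ 2)%R.
rewrite powRM ?exprn_ge0 ?(ltW r0) ?(ltW w0)// mulrC; congr (_ * _)%R.
rewrite -powR_mulrn ?(ltW r0)// -powRrM; congr (_ `^ _)%R.
rewrite /e; field; rewrite !gt_eqF ?ltr0n//.
Qed.

(** P is the real or the imaginary part.  Dividing P (l_k a_k) by c_k = |l_k| gives
    real blocks v_k dominated by |a_k|; if c_k = 0 the quotient is 0, as it should
    be. *)
Lemma part_superposition (P : R[i] -> R) (f : Rn -> R[i]) :
  (forall z w, P (z - w) = P z - P w)%R -> (forall z, `|P z| <= cabs z)%R ->
  (forall (l : R[i]) (a : Rn -> R[i]), cmeasurable a -> measurable_fun setT (fun x => P (l * a x)%R)) ->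
  block_space p 2%:E alpha f ->
  exists H : R -> Rn -> \bar R,
  [/\ forall t x, 0 <= H t x,
      forall t, measurable_fun setT (H t),
      forall t, (0 < t)%R -> {ae mu, forall x,
        (`|avg (P \o f) t x - P (f x)| `^ p * enorm x `^ alpha)%:E <= H t x} &
      tends0 (fun t => \int[mu]_x H t x)].
Proof.
move=> PB Pabs Pm [l [a [ba lfin [N [mN N0 sub]]]]].
have P0 : P 0%R = 0%R by rewrite -(subrr 0%R) PB subrr.
have PN z : P (- z)%R = (- P z)%R by rewrite -sub0r PB P0 sub0r.
have PD z w : P (z + w)%R = (P z + P w)%R by rewrite -[w in LHS]opprK PB PN opprK.
pose c k := cabs (l k).
have c0 k : (0 <= c k)%R by exact: cabs_ge0.
pose v k x := ((c k)^-1 * P (l k * a k x))%R.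
have cv k x : (c k * v k x)%R = P (l k * a k x)%R.
  have [ck|ck] := eqVneq (c k) 0%R; last by rewrite /v mulVKf.
  have /Normc.eq0_normc -> : Normc.normc (l k) = 0%R by exact: ck.
  by rewrite ck !mul0r P0.
have va k x : (`|v k x| <= cabs (a k x))%R.
  rewrite /v normrM ger0_norm ?invr_ge0//.
  have [->|ck] := eqVneq (c k) 0%R; first by rewrite invr0 mul0r cabs_ge0.
  by rewrite ler_pdivrMl ?lt_neqAle ?c0 1?eq_sym ?ck// -cabsM.
have bk k : exists xr : Rn * R, [/\ (0 < xr.2)%R,
    forall x, ~ eball xr.1 xr.2 x -> a k x = 0%R &
    ('N[mu]_2%:E [EFin \o (cabs \o a k)] <=
     mu (eball xr.1 xr.2) `^ (- (alpha / (p * n%:R)) - p^-1 + fine ((2%:E : \bar R)^-1)))].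
  by have [_ [x [r H]]] := ba k; exists (x, r).
pose xr k := projT1 (cid (bk k)).
have xrP k := projT2 (cid (bk k)).
set M := (vol1 (R := R) (n := n) `^ (- (alpha / (p * n%:R)) - p^-1 + 2^-1))%R.
have M0 : (0 < M)%R by rewrite powR_gt0// vol1_gt0.
have mv k : measurable_fun setT (v k).
  by apply: measurable_funM => //; apply: Pm; have [] := ba k.
apply: (tends0_superposition p alpha n0 p0 p2 alo aup a0 c v
  (fun k => (xr k).1) (fun k => (xr k).2) M c0 lfin mv _ _ M0 _ (P \o f) N mN N0).
- by move=> k x xK; have [_ /(_ x xK) ax _] := xrP k; rewrite /v ax mulr0 P0 mulr0.
- by move=> k; have [] := xrP k.
- move=> k; have [r0 _ ak] := xrP k.
  apply: le_trans (block_sqr_le (a k) _ _ r0 ak).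
  have mca : measurable_fun setT (fun x => (cabs (a k x) ^+ 2)%:E).
    have [[mre mim] _] := ba k.
    apply/measurable_EFinP.
    rewrite (_ : (fun x => _) = fun x => (complex.Re (a k x) ^+ 2 + complex.Im (a k x) ^+ 2)%R).
      by apply: measurable_funD; exact: measurable_funX.
    by apply/funext => x; rewrite cabsE sqr_sqrtr// addr_ge0// sqr_ge0.
  apply: ge0_le_integral => //.
  + by move=> x _; rewrite lee_fin sqr_ge0.
  + exact: measurable_sqrE.
  + move=> x _; rewrite lee_fin -[leLHS]real_normK ?num_real//.
    by rewrite lerXn2r ?nnegrE ?cabs_ge0.
move=> x Nx.
have cf : cabs (f x - \sum_(k < m) l k * a k x)%R @[m --> \oo] --> (0%R : R).
  by apply: contrapT => h; apply: Nx; apply: sub => /= h'; exact: h.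
have PS m : P (\sum_(k < m) l k * a k x)%R = (\sum_(0 <= k < m) c k * v k x)%R.
  rewrite big_mkord; elim: m => [|m IH]; first by rewrite !big_ord0 P0.
  by rewrite !big_ord_recr/= PD IH cv.
apply/cvgrPdist_le => e e0.
move/cvgrPdist_le: cf => /(_ e e0); apply: filterS => m.
rewrite sub0r normrN ger0_norm ?cabs_ge0// => h.
by rewrite /= -PS -PB (le_trans (Pabs _)).
Qed.

Lemma tends0_weighted_norm (f : Rn -> R[i]) : block_space p 2%:E alpha f ->
  tends0 (fun t => weighted_norm p alpha (fun x => spherical_mean f t x - f x)%R).
Proof.
move=> hf.
have [|||H1 [H10 mH1 H1le H1t]] := part_superposition (@complex.Re R) f _ _ _ hf.
- by case=> ? ? [? ?].
- exact: normr_Re_le.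
- move=> [x y] a [mre mim].
  rewrite (_ : (fun z => _) = fun z => (x * complex.Re (a z) - y * complex.Im (a z))%R).
    by apply: measurable_funB; exact: measurable_funM.
  by apply/funext => z; case: (a z).
have [|||H2 [H20 mH2 H2le H2t]] := part_superposition (@complex.Im R) f _ _ _ hf.
- by case=> ? ? [? ?].
- exact: normr_Im_le.
- move=> [x y] a [mre mim].
  rewrite (_ : (fun z => _) = fun z => (x * complex.Im (a z) + y * complex.Re (a z))%R).
    by apply: measurable_funD; exact: measurable_funM.
  by apply/funext => z; case: (a z).
have tp : (0 < 2 `^ p :> R)%R by exact: powR_gt0.
have T := tends0Z _ _ (ltW tp) (tends0D _ _ H1t H2t).
move=> e e0; have [d d0 Hd] := T _ (powR_gt0 p e0).
exists d => // t t0 td; have {}Hd := Hd t t0 td.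
have -> : e%:E = (e `^ p)%:E `^ p^-1.
  by rewrite poweR_EFin -powRrM mulfV ?gt_eqF// powRr1// ltW.
have i0 : 0 <= \int[mu]_x (cabs (spherical_mean f t x - f x) `^ p * enorm x `^ alpha)%:E.
  by apply: integral_ge0 => x _; rewrite lee_fin mulr_ge0// powR_ge0.
rewrite /weighted_norm; apply: gt0_ler_poweR;
  rewrite ?in_itv/= ?leey ?andbT ?invr_ge0 ?lee_fin ?powR_ge0 ?(ltW p0)//.
apply: le_trans Hd.
rewrite -ge0_integralD// -ge0_integralZl//; last 2 first.
- exact: emeasurable_funD.
- by move=> x _; rewrite adde_ge0.
have [N [mN N0 sub]] : {ae mu, forall x,
   (cabs (spherical_mean f t x - f x) `^ p * enorm x `^ alpha)%:E <=
     (2 `^ p)%:E * (H1 t x + H2 t x)}.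
  apply: filterS2 (H1le t t0) (H2le t t0) => x h1 h2.
  apply: (@le_trans _ _ ((2 `^ p)%:E *
    ((`|avg (@complex.Re R \o f) t x - complex.Re (f x)| `^ p * enorm x `^ alpha)%:E +
     (`|avg (@complex.Im R \o f) t x - complex.Im (f x)| `^ p * enorm x `^ alpha)%:E))).
    rewrite -EFinD -EFinM lee_fin -mulrDl mulrA; apply: ler_wpM2r; first exact: powR_ge0.
    have := powR_cabs_le p (spherical_mean f t x - f x)%R p0.
    by rewrite /spherical_mean; case: (f x).
  by apply: lee_wpmul2l; [rewrite lee_fin ltW|exact: leeD].
apply: (integral_le_ae mu N _ _ mN N0).
- by move=> x; rewrite lee_fin mulr_ge0// powR_ge0.
- by move=> x; rewrite mule_ge0 ?adde_ge0// lee_fin ltW.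
- by apply: measurable_funeM; exact: emeasurable_funD.
- by move=> x Nx; apply: contrapT => h; apply: Nx; exact: sub.
Qed.

End main.

Theorem theorem6p3 (R : realType) (n : nat) (p alpha : R)
    (hn : (3 <= n)%N) (hp0 : 0 < p) (hp2 : p < 2)
    (halpha_lo : n%:R * (2^-1 * p - 1) < alpha)
    (halpha_up : alpha < n%:R * ((n%:R - 1) / n%:R * p - 1))
    (halpha0 : alpha <= 0)
    (f : n.-tuple R -> R[i]) (hf : block_space p 2%:E alpha f) :
  weighted_norm p alpha (fun x => spherical_mean f t x - f x)
    @[t --> 0^'+] --> 0%E.
Proof.
have n0 : (0 < n)%N by exact: leq_trans hn.
apply: tends0_cvg; first by move=> t; exact: poweR_ge0.
exact: tends0_weighted_norm.
Qed.
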